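(* Let $k$ be a positive integer. For any signed Eulerian graph $(G,\sigma)$, if $G$ is $(6k-2)$-edge-connected, then $\Phi_c(G,\sigma)\le\frac{4k}{2k-1}$.
   Context: Graphs are finite, may have multiple edges but no loops; a signed graph $(G,\sigma)$ has $\sigma:E(G)\to\{+,-\}$; it is Eulerian if $G$ is connected and all degrees are even. For an orientation $D$ and $f:E(G)\to\mathbb{R}$, $\partial_Df(v)$ is the sum of $f$ over out-arcs at $v$ minus the sum over in-arcs. A circular $r$-flow ($r\ge2$) is a pair $(D,f)$ with $f:E(G)\to(-r,r)$ such that $|f(e)|\in[1,r-1]$ for positive edges, $|f(e)|\in[0,\frac r2-1]\cup[\frac r2+1,r)$ for negative edges, and $\partial_Df(v)=0$ at every vertex. $\Phi_c(G,\sigma)$ is the infimum of $r$ for which such a flow exists. *)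

(* Defs.v *)
From HB Require Import structures.
From mathcomp Require Import all_boot all_order all_algebra.
From mathcomp Require Import all_classical all_reals all_analysis.

Set Implicit Arguments.
Unset Strict Implicit.
Unset Printing Implicit Defensive.

Import Order.TTheory GRing.Theory Num.Theory.

(* Two edges may have the same end set (parallel edges); loops are excluded
   because an end set has exactly two elements. *)
Record multigraph := Multigraph {
  vertex : finType;
  edge : finType;
  ends : edge -> {set vertex};
  card_ends : forall e, #|ends e| = 2
}.

(* true is the sign +, false is the sign -. *)
Definition signature (G : multigraph) := edge G -> bool.

Section Graph.
Variable G : multigraph.

Definition degree (v : vertex G) : nat := #|[set e : edge G | v \in ends e]|.

Definition adj_without (F : {set edge G}) : rel (vertex G) :=
  fun u v => [exists e : edge G, (e \notin F) && (ends e == [set u; v]%SET)].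

Definition connected_without (F : {set edge G}) : Prop :=
  (0 < #|vertex G|)%N /\
  forall u v : vertex G, fingraph.connect (adj_without F) u v.

Definition graph_connected : Prop := connected_without finset.set0.

Definition edge_connected (m : nat) : Prop :=
  forall F : {set edge G}, (#|F| < m)%N -> connected_without F.

Definition eulerian : Prop :=
  graph_connected /\ forall v : vertex G, ~~ odd (degree v).

(* The arc of e goes from tail e to head e. *)
Record orientation := Orientation {
  tail : edge G -> vertex G;
  head : edge G -> vertex G;
  orientationE : forall e, ends e = [set tail e; head e]%SET
}.

End Graph.

Local Open Scope ring_scope.

Section Flow.
Variables (R : realType) (G : multigraph).

Definition boundary (D : orientation G) (f : edge G -> R) (v : vertex G) : R :=
  \sum_(e | tail D e == v) f e - \sum_(e | head D e == v) f e.

Definition circular_flow (sigma : signature G) (r : R)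
    (D : orientation G) (f : edge G -> R) : Prop :=
  [/\ forall e, - r < f e < r,
      forall e, sigma e -> 1 <= `|f e| <= r - 1,
      forall e, ~~ sigma e ->
        (0 <= `|f e| <= r / 2 - 1) || (r / 2 + 1 <= `|f e| < r)
    & forall v, boundary D f v = 0].

(* Taken in the extended reals, so that the index is +oo, rather than a junk
   real value, when no circular flow exists. *)
Definition circular_flow_index (sigma : signature G) : \bar R :=
  ereal_inf [set r%:E | r in
    [set r : R | 2 <= r /\ exists D f, circular_flow sigma r D f]].

End Flow.

(* Main.v *)
Require Import Defs.
From HB Require Import structures.
From mathcomp Require Import all_boot all_order all_algebra zify ring lra.

(** Scaling by 2k - 1, a circular 4k/(2k-1)-flow may be sought with integer
    values of absolute value 2k - 1 or 2k + 1 on positive edges and 1 or 4k - 1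
    on negative edges.  Modulo 4k these are the values 2k + 1, 2k - 1, resp.
    1, -1, so an orientation whose outdegree minus indegree at v is 2k times
    the number of positive edges at v, modulo 4k, gives such a flow modulo 4k;
    a flow modulo 4k lifts to an integer flow by choosing for each edge one of
    the two representatives in (-4k, 4k).

    The orientation exists by the theorem of Lovasz, Thomassen, Wu and Zhang on
    modulo orientations.  Put m = 2k and let N q be the distance from q to 2mZ.
    One proves by induction a statement with a special vertex z0 whose edges
    are already oriented, under the hypotheses d(z0) <= 2m - 2 + N(demand of z0)
    and d(A) >= 2m - 2 + N(demand of A) for the other cuts.  A nontrivial cut
    where equality holds is contracted on both sides in turn.  Otherwise all
    nontrivial cuts have slack 2, so a vertex of zero demand can be split off
    pair by pair, and an edge whose ends have demands of opposite signs can be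
    oriented and deleted.  When all demands have the same sign, one edge is
    traded for arcs at z0. *)

Set Implicit Arguments.
Unset Strict Implicit.
Unset Printing Implicit Defensive.

Import Order.TTheory GRing.Theory Num.Theory.
Local Open Scope ring_scope.

(** * Distance to the multiples of 2m *)

Definition dist_mod (m q : int) : int :=
  Num.min (q %% (2 * m))%Z (2 * m - (q %% (2 * m))%Z).

Definition eqmod (m p q : int) : Prop := exists j : int, p = q + j * (2 * m).

Section DistMod.
Variable m : int.
Hypothesis m_gt0 : 0 < m.
Notation N := (dist_mod m).

Lemma dist_mod_bounds q : 0 <= N q <= m.
Proof.
have h0 : 0 <= (q %% (2 * m))%Z by apply: modz_ge0; lia.
have h1 : (q %% (2 * m))%Z < 2 * m by apply: ltz_pmod; lia.
rewrite /dist_mod; lia.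
Qed.

Lemma dist_mod_rep q : eqmod m q (N q) \/ eqmod m q (- N q).
Proof.
rewrite /eqmod /dist_mod.
have hq := divz_eq q (2 * m).
have h0 : 0 <= (q %% (2 * m))%Z by apply: modz_ge0; lia.
set d := (q %/ _)%Z in hq; set r := (q %% _)%Z in hq h0 *.
case: (leP r (2 * m - r)) => h; [left; exists d | right; exists (d + 1)]; lia.
Qed.

Lemma dist_mod_le q r : eqmod m q r -> N q <= `|r|.
Proof.
case=> j ->; rewrite addrC /dist_mod modzMDl.
have h0 : 0 <= (r %% (2 * m))%Z by apply: modz_ge0; lia.
have h1 : (r %% (2 * m))%Z < 2 * m by apply: ltz_pmod; lia.
have hq := divz_eq r (2 * m).
set d := (r %/ _)%Z in hq; set s := (r %% _)%Z in hq h0 h1 *.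
(* Here r = 2md + s: for d >= 0 this gives r >= s, otherwise -r >= 2m - s. The sign of the product
   of d and m has to be supplied. *)
have [hd|hd] : 0 <= d \/ d <= -1 by lia.
- have : 0 <= d * m by apply: mulr_ge0; lia.
  lia.
- have : 0 <= (- 1 - d) * m by apply: mulr_ge0; lia.
  lia.
Qed.

Lemma eqmod_refl q : eqmod m q q. Proof. by exists 0; lia. Qed.

Lemma dist_mod_congr p q : eqmod m p q -> N p = N q.
Proof. by case=> j ->; rewrite addrC /dist_mod modzMDl. Qed.

Lemma dist_modN q : N (- q) = N q.
Proof.
suff h p : N (- p) <= N p by have := h q; have := h (- q); rewrite opprK; lia.
have := dist_mod_bounds p.
case: (dist_mod_rep p) => -[j e].
- have := @dist_mod_le (- p) (- N p); rewrite /eqmod => h; have := h ltac:(exists (- j); lia); lia.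
- have := @dist_mod_le (- p) (N p); rewrite /eqmod => h; have := h ltac:(exists (- j); lia); lia.
Qed.

(** Representatives of p and q of least absolute value add up to a representative of p + q. *)
Lemma dist_modD p q : N (p + q) <= N p + N q.
Proof.
have := dist_mod_bounds p; have := dist_mod_bounds q.
case: (dist_mod_rep p) => -[i ei]; case: (dist_mod_rep q) => -[j ej];
  move: ei ej; set a := N p; set b := N q => ei ej.
- have := @dist_mod_le (p + q) (a + b) ltac:(exists (i + j); lia); lia.
- have := @dist_mod_le (p + q) (a - b) ltac:(exists (i + j); lia); lia.
- have := @dist_mod_le (p + q) (b - a) ltac:(exists (i + j); lia); lia.
- have := @dist_mod_le (p + q) (- a - b) ltac:(exists (i + j); lia); lia.
Qed.

Lemma dist_mod_lip p q : N p <= N q + `|p - q|.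
Proof.
have := dist_modD q (p - q); have := dist_mod_le (eqmod_refl (p - q)).
by rewrite [q + _]addrC subrK; set a := N (p - q); lia.
Qed.

(** The modulus 2m is even. With [deg_dem] it follows that a degree and the distance of the
    corresponding demand have equal parity, so the cut bounds improve in steps of 2. *)
Lemma dist_mod_parity q : exists j : int, q - N q = j * 2.
Proof.
case: (dist_mod_rep q) => -[j]; set a := N q => e; first by exists (j * m); lia.
by exists (j * m - a); lia.
Qed.

Lemma dist_mod_small q : 0 <= q <= m -> N q = q.
Proof. by move=> h; rewrite /dist_mod modz_small; lia. Qed.

Lemma dist_mod0 q : N q = 0 -> eqmod m q 0.
Proof. by move=> h; case: (dist_mod_rep q); rewrite h ?oppr0. Qed.

End DistMod.

(** * Networks, demands and the induction measure *)

Section Network.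
Variables (E V : finType) (m : int).
Hypothesis m_gt1 : 1 < m.
Let m_gt0 : 0 < m. Proof. lia. Qed.
Notation N := (dist_mod m).

(* The vertex z0 of Lovasz-Thomassen-Wu-Zhang, all of whose edges are already
   oriented, is not a vertex of the network: [ain x] and [aout x] count the
   arcs from z0 to x and from x to z0, and [rho x] is what remains to be
   realised at x by the other edges.  Deleted edges are turned into loops. *)
Record network := Network {
  verts : {set V};
  src : E -> V;
  tgt : E -> V;
  rho : V -> int;
  ain : V -> int;
  aout : V -> int }.

Definition cut (s t : E -> V) (A : {set V}) : int :=
  \sum_e ((s e \in A) (+) (t e \in A))%:Z.

Definition deg G (A : {set V}) := cut (src G) (tgt G) A + \sum_(x in A) (ain G x + aout G x).

(** The arcs at z0 are counted back in, so this is the net outdegree prescribed for A in the whole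
    graph. In an admissible network [rho] sums to 0 modulo 2m, so the demand of [verts] is minus
    that of z0, and [deg] of [verts] is the degree of z0. *)
Definition dem G (A : {set V}) := \sum_(x in A) (rho G x + aout G x - ain G x).

Definition sg (b : bool) : int := if b then 1 else -1.

Definition outflow (s t : E -> V) (o : E -> bool) (A : {set V}) : int :=
  \sum_e sg (o e) * ((s e \in A)%:Z - (t e \in A)%:Z).

Definition solvable G := exists o : E -> bool,
  forall v, v \in verts G -> eqmod m (outflow (src G) (tgt G) o [set v]) (rho G v).

(* Cuts consisting of the single vertex x1 are exempt from the lower bound while
   x1 has zero demand: x1 is the vertex being split off. *)
Record admissible (G : network) (x1 : V) : Prop := Admissible {
  src_in : forall e, src G e \in verts G;
  tgt_in : forall e, tgt G e \in verts G;
  ain_ge0 : forall x, 0 <= ain G x;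
  aout_ge0 : forall x, 0 <= aout G x;
  rho_sum : eqmod m (\sum_(x in verts G) rho G x) 0;
  deg_dem : forall A : {set V}, A \subset verts G -> exists j : int, deg G A - dem G A = j * 2;
  deg_ub : deg G (verts G) <= 2 * m - 2 + N (dem G (verts G));
  deg_lb : forall A : {set V}, A \subset verts G -> A != set0 -> A != verts G ->
    A = [set x1] /\ N (dem G A) = 0 \/ 2 * m - 2 + N (dem G A) <= deg G A }.

Definition nonloops G := #|[pred e | src G e != tgt G e]|.

(** Lexicographic in vertices, remaining edges and arcs at z0. Cutting along a tight set decreases
    the first, splitting off or orienting an edge the second, removing an arc at z0 the third. *)
Definition smaller G' G :=
  (#|verts G'| < #|verts G|)%N \/ #|verts G'| = #|verts G| /\
  ((nonloops G' < nonloops G)%N \/ nonloops G' = nonloops G /\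
   deg G' (verts G') < deg G (verts G)).

Definition slack G := forall A : {set V}, A \subset verts G -> (1 < #|A|)%N ->
  A != verts G -> 2 * m + N (dem G A) <= deg G A.

Definition joins G e x y :=
  (src G e == x) && (tgt G e == y) || (src G e == y) && (tgt G e == x).

Lemma sum_delta (A : {set V}) p (c : int) :
  \sum_(x in A) c * (x == p)%:Z = c * (p \in A)%:Z.
Proof.
have [pA|pA] := boolP (p \in A).
  rewrite (bigD1 p) //= eqxx big1 ?addr0 // => x /andP[_ /negPf->]; by rewrite mulr0.
by rewrite big1 ?mulr0 // => x xA; case: eqP => [e|]; rewrite ?mulr0 //; move: pA; rewrite -e xA.
Qed.

Lemma cut_verts G x1 : admissible G x1 -> cut (src G) (tgt G) (verts G) = 0.
Proof. by move=> aG; rewrite /cut big1 // => e _; rewrite (src_in aG) (tgt_in aG). Qed.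

Lemma cut_ge0 s t A : 0 <= cut s t A.
Proof. by apply: sumr_ge0. Qed.

(** * Orienting and deleting an edge *)

(** The edge e0 is directed from x to y and left as a loop. The parameters change the numbers of
    arcs between z0 and x, y; [solvable] does not see these arcs, so they can be chosen to preserve
    the cut bounds. *)
Definition orient_edge G e0 x y (ax ay bx by_ : int) :=
  Network (verts G) (src G) (fun e => if e == e0 then src G e else tgt G e)
    (fun v => rho G v - (v == x)%:Z + (v == y)%:Z)
    (fun v => ain G v + ax * (v == x)%:Z + ay * (v == y)%:Z)
    (fun v => aout G v + bx * (v == x)%:Z + by_ * (v == y)%:Z).

Section OrientEdge.
Variables (G : network) (e0 : E) (x y : V) (ax ay bx by_ : int).
Hypothesis e0xy : joins G e0 x y.
Let G' := orient_edge G e0 x y ax ay bx by_.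

Lemma deg_orient_edge A : deg G' A = deg G A - ((x \in A) (+) (y \in A))%:Z
  + (ax + bx) * (x \in A)%:Z + (ay + by_) * (y \in A)%:Z.
Proof.
rewrite /deg /cut /= (bigD1 e0) //= [in RHS](bigD1 e0) //= eqxx addbb.
under eq_bigr => e /negPf-> do [].
rewrite [X in _ + X = _](eq_bigr (fun v => ain G v + aout G v
  + ((ax + bx) * (v == x)%:Z + (ay + by_) * (v == y)%:Z))); last by move=> v _; lia.
rewrite !big_split /= !sum_delta.
suff -> : (src G e0 \in A) (+) (tgt G e0 \in A) = (x \in A) (+) (y \in A) by lia.
by case/orP: e0xy => /andP[/eqP-> /eqP->] //; rewrite addbC.
Qed.

Lemma dem_orient_edge A : dem G' A = dem G A
  + (bx - ax - 1) * (x \in A)%:Z + (by_ - ay + 1) * (y \in A)%:Z.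
Proof.
rewrite /dem /=.
rewrite (eq_bigr (fun v => (rho G v + aout G v - ain G v)
  + ((bx - ax - 1) * (v == x)%:Z + (by_ - ay + 1) * (v == y)%:Z))); last by move=> v _; lia.
by rewrite !big_split /= !sum_delta; lia.
Qed.

Lemma solvable_orient_edge : solvable G' -> solvable G.
Proof.
case=> o ho; exists (fun e => if e == e0 then src G e == x else o e) => v vS.
have [j] := ho v vS; rewrite /outflow /= (bigD1 e0) //= eqxx subrr mulr0 add0r => h.
exists j; rewrite /outflow (bigD1 e0) //= eqxx.
move: h; under eq_bigr => e /negPf-> do [].
under [X in _ -> _ + X = _]eq_bigr => e /negPf-> do [].
move=> ->; rewrite !inE.
case: (eqVneq (src G e0) x) => [ex|nx].
- suff -> : tgt G e0 = y by rewrite /sg ex [x == v]eq_sym [y == v]eq_sym; lia.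
  by case/orP: e0xy => /andP[/eqP e1 /eqP e2] //; rewrite e2 -ex e1.
- case/orP: e0xy => /andP[/eqP e1 /eqP e2]; first by rewrite e1 eqxx in nx.
  by rewrite /sg e1 e2 [x == v]eq_sym [y == v]eq_sym; lia.
Qed.

Lemma nonloops_orient_edge : x != y -> (nonloops G' < nonloops G)%N.
Proof.
move=> xy; apply: proper_card; apply/properP; split.
  by apply/subsetP => e; rewrite !inE /=; case: (e == e0) => //; rewrite eqxx.
exists e0; rewrite !inE /= ?eqxx //.
by case/orP: e0xy => /andP[/eqP-> /eqP->] //; rewrite eq_sym.
Qed.

(** Degree and demand of every set change by the same parity and [rho] keeps its sum. What depends
    on the parameters is the nonnegativity of the arc counts and the two degree bounds, which remain
    as premises. *)
Lemma admissible_orient_edge x1 x1' : x != y -> admissible G x1 ->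
  0 <= ain G x + ax -> 0 <= ain G y + ay ->
  0 <= aout G x + bx -> 0 <= aout G y + by_ ->
  deg G' (verts G) <= 2 * m - 2 + N (dem G' (verts G)) ->
  (forall A : {set V}, A \subset verts G -> A != set0 -> A != verts G ->
    A = [set x1'] /\ N (dem G' A) = 0 \/ 2 * m - 2 + N (dem G' A) <= deg G' A) ->
  admissible G' x1'.
Proof.
move=> xy aG ax0 ay0 bx0 by0 ub lb.
have [xS yS] : x \in verts G /\ y \in verts G.
  have := src_in aG e0; have := tgt_in aG e0.
  by case/orP: e0xy => /andP[/eqP-> /eqP->].
split=> //=.
- exact: src_in aG.
- by move=> e; case: ifP => _; [apply: src_in aG _ | apply: tgt_in aG _].
- move=> v; have := ain_ge0 aG v.
  case: (eqVneq v x) => [->|_]; case: eqVneq => [e|_]; rewrite ?e in ax0 ay0 xy *;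
   rewrite ?eqxx // in xy *; lia.
- move=> v; have := aout_ge0 aG v.
  case: (eqVneq v x) => [->|_]; case: eqVneq => [e|_]; rewrite ?e in bx0 by0 xy *;
   rewrite ?eqxx // in xy *; lia.
- have [j hj] := rho_sum aG; exists j; rewrite -hj.
  rewrite (eq_bigr (fun v => rho G v
    + ((- 1) * (v == x)%:Z + 1 * (v == y)%:Z))); last by move=> v _; lia.
  rewrite !big_split /= !sum_delta xS yS.
  by rewrite mulN1r mul1r addNr addr0.
- move=> A AS; have [j hj] := deg_dem aG AS.
  rewrite deg_orient_edge dem_orient_edge.
  case: (x \in A); case: (y \in A) => /=.
  + by exists (j + ax + ay); lia.
  + by exists (j + ax); lia.
  + by exists (j + ay - 1); lia.
  + by exists j; lia.
Qed.

End OrientEdge.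

(** * Splitting off a pair of edges *)

Lemma sgN b : sg (~~ b) = - sg b. Proof. by case: b. Qed.

Section LiftEdges.
Variables (G : network) (e1 e2 : E) (u x v : V).
Hypotheses (e1ux : joins G e1 u x) (e2xv : joins G e2 x v) (e12 : e1 != e2).

(** The edge e1 now stands for the path u, x, v, and e2 is deleted. *)
Definition lift_edges :=
  Network (verts G) (fun e => if e == e1 then u else src G e)
    (fun e => if e == e1 then v else if e == e2 then src G e else tgt G e)
    (rho G) (ain G) (aout G).
Let G' := lift_edges.
Let e21 : (e2 == e1) = false. Proof. by rewrite eq_sym (negPf e12). Qed.

Lemma deg_lift_edges A : deg G' A = deg G A - ((u \in A) (+) (x \in A))%:Z
  - ((x \in A) (+) (v \in A))%:Z + ((u \in A) (+) (v \in A))%:Z.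
Proof.
rewrite /deg /cut /= (bigD1 e1) //= (bigD1 e2) /= ?e21 //.
rewrite [in RHS](bigD1 e1) //= [in RHS](bigD1 e2) /= ?e21 //.
rewrite !eqxx ?e21 addbb.
under eq_bigr => e /andP[/negPf-> /negPf->] do [].
have -> : (src G e1 \in A) (+) (tgt G e1 \in A) = (u \in A) (+) (x \in A).
  by case/orP: e1ux => /andP[/eqP-> /eqP->] //; rewrite addbC.
have -> : (src G e2 \in A) (+) (tgt G e2 \in A) = (x \in A) (+) (v \in A).
  by case/orP: e2xv => /andP[/eqP-> /eqP->] //; rewrite addbC.
lia.
Qed.

Lemma solvable_lift_edges : solvable G' -> solvable G.
Proof.
(* Both edges are directed along the path u, x, v if the new edge goes from u to v, and against it
   otherwise; the net outflow of x is unaffected. *)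
case=> o ho; exists (fun e => if e == e1 then (src G e1 == u) (+) ~~ o e1 else
  if e == e2 then (src G e2 == x) (+) ~~ o e1 else o e) => w wS.
have [j] := ho w wS; rewrite /outflow /= (bigD1 e1) //= (bigD1 e2) /= ?e21 //.
rewrite !eqxx ?e21 subrr mulr0 add0r => h.
exists j; rewrite -h.
rewrite [in LHS](bigD1 e1) //= [in LHS](bigD1 e2) /= ?e21 //.
rewrite !eqxx ?e21.
rewrite addrA; congr (_ + _); last first.
  by apply: eq_bigr => e /andP[/negPf-> /negPf->].
rewrite !inE.
have -> : sg ((src G e1 == u) (+) ~~ o e1) * ((src G e1 == w)%:Z - (tgt G e1 == w)%:Z)
   = sg (o e1) * ((u == w)%:Z - (x == w)%:Z).
  case: (eqVneq (src G e1) u) => [eu|nu].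
    suff -> : tgt G e1 = x by rewrite eu; case: (o e1).
    by case/orP: e1ux => /andP[/eqP h1 /eqP h2] //; rewrite h2 -eu h1.
  case/orP: e1ux => /andP[/eqP h1 /eqP h2]; first by rewrite h1 eqxx in nu.
  by rewrite h1 h2 addFb sgN mulNr -mulrN opprB.
have -> : sg ((src G e2 == x) (+) ~~ o e1) * ((src G e2 == w)%:Z - (tgt G e2 == w)%:Z)
   = sg (o e1) * ((x == w)%:Z - (v == w)%:Z).
  case: (eqVneq (src G e2) x) => [eu|nu].
    suff -> : tgt G e2 = v by rewrite eu; case: (o e1).
    by case/orP: e2xv => /andP[/eqP h1 /eqP h2] //; rewrite h2 -eu h1.
  case/orP: e2xv => /andP[/eqP h1 /eqP h2]; first by rewrite h1 eqxx in nu.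
  by rewrite h1 h2 addFb sgN mulNr -mulrN opprB.
by rewrite -mulrDr addrA subrK.
Qed.

Lemma nonloops_lift_edges : u != x -> x != v -> (nonloops G' < nonloops G)%N.
Proof.
move=> ux xv; apply: proper_card; apply/properP; split.
  apply/subsetP => e; rewrite !inE /=; case: (eqVneq e e1) => [->|_].
    by case/orP: e1ux => /andP[/eqP-> /eqP->] // _; rewrite eq_sym.
  by case: (e == e2) => //; rewrite eqxx.
exists e2; rewrite !inE /= ?e21 ?eqxx //.
by case/orP: e2xv => /andP[/eqP-> /eqP->] //; rewrite eq_sym.
Qed.

Lemma admissible_lift_edges x1 : admissible G x1 ->
  deg G' (verts G) <= 2 * m - 2 + N (dem G (verts G)) ->
  (forall A : {set V}, A \subset verts G -> A != set0 -> A != verts G ->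
    A = [set x1] /\ N (dem G A) = 0 \/ 2 * m - 2 + N (dem G A) <= deg G' A) ->
  admissible G' x1.
Proof.
move=> aG ub lb.
have [uS vS] : u \in verts G /\ v \in verts G.
  have := src_in aG e1; have := tgt_in aG e1; have := src_in aG e2; have := tgt_in aG e2.
  by case/orP: e1ux => /andP[/eqP-> /eqP->]; case/orP: e2xv => /andP[/eqP-> /eqP->].
split=> //=.
- by move=> e; case: ifP => // _; apply: src_in aG _.
- by move=> e; do 2 case: ifP => // _; [apply: src_in aG _ | apply: tgt_in aG _].
- exact: ain_ge0 aG.
- exact: aout_ge0 aG.
- exact: rho_sum aG.
- move=> A AS; have [j hj] := deg_dem aG AS.
  rewrite deg_lift_edges -[dem _ A]/(dem G A).
  clear -hj; case: (u \in A); case: (x \in A); case: (v \in A) => /=;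
   by [exists j; lia | exists (j - 1); lia].
Qed.

End LiftEdges.

(** * Reversing the network and removing an arc at z0 *)

(** All demands change sign, which reduces the case of negative demands to that of positive ones. *)
Definition reverse (G : network) :=
  Network (verts G) (src G) (tgt G) (fun v => - rho G v) (aout G) (ain G).

Lemma deg_reverse G A : deg (reverse G) A = deg G A.
Proof. by congr (_ + _); apply: eq_bigr => v _; rewrite addrC. Qed.

Lemma dem_reverse G A : dem (reverse G) A = - dem G A.
Proof. by rewrite /dem -sumrN; apply: eq_bigr => v _ /=; lia. Qed.

Lemma solvable_reverse G : solvable (reverse G) -> solvable G.
Proof.
case=> o ho; exists (fun e => ~~ o e) => v vS; have [j hj] := ho v vS.
exists (- j); rewrite (_ : outflow _ _ _ _ = - outflow (src G) (tgt G) o [set v]).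
  by move: hj => /=; lia.
by rewrite /outflow -sumrN; apply: eq_bigr => e _; rewrite sgN mulNr.
Qed.

Lemma admissible_reverse G x1 : admissible G x1 -> admissible (reverse G) x1.
Proof.
move=> aG; split=> //=; try by case: aG.
- by have [j hj] := rho_sum aG; exists (- j); rewrite sumrN hj; lia.
- move=> A AS; have [j hj] := deg_dem aG AS; rewrite deg_reverse dem_reverse.
  by exists (j + dem G A); lia.
- by rewrite deg_reverse dem_reverse dist_modN //; apply: deg_ub aG.
- by move=> A AS A0 A1; rewrite deg_reverse dem_reverse dist_modN //; apply: deg_lb aG _ _ _ _.
Qed.

(** Since [rho] is kept, the orientations sought are the same; only degrees and demands drop. *)
Definition remove_aout (G : network) x :=
  Network (verts G) (src G) (tgt G) (rho G) (ain G)
    (fun v => aout G v - (v == x)%:Z).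

Lemma deg_remove_aout G x A : deg (remove_aout G x) A = deg G A - (x \in A)%:Z.
Proof.
rewrite /deg /= (eq_bigr (fun v => ain G v + aout G v + (-1) * (v == x)%:Z)).
  by rewrite big_split /= sum_delta mulN1r ?addrA.
by move=> v _; lia.
Qed.

Lemma dem_remove_aout G x A : dem (remove_aout G x) A = dem G A - (x \in A)%:Z.
Proof.
rewrite /dem /= (eq_bigr (fun v => rho G v + aout G v - ain G v + (-1) * (v == x)%:Z)).
  by rewrite big_split /= sum_delta mulN1r ?addrA.
by move=> v _; lia.
Qed.

Lemma admissible_remove_aout G x x1 : admissible G x1 -> 0 < aout G x ->
  deg G (verts G) - (x \in verts G)%:Z <= 2 * m - 2 + N (dem G (verts G) - (x \in verts G)%:Z) ->
  (forall A : {set V}, A \subset verts G -> A != set0 -> A != verts G ->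
    2 * m - 2 + N (dem G A - (x \in A)%:Z) <= deg G A - (x \in A)%:Z) ->
  admissible (remove_aout G x) x1.
Proof.
move=> aG x0 ub lb; split=> //=; try by case: aG.
- by move=> v; have := aout_ge0 aG v; case: (eqVneq v x) => [->|_]; lia.
- move=> A AS; have [j hj] := deg_dem aG AS; exists j.
  by rewrite deg_remove_aout dem_remove_aout; lia.
- by rewrite deg_remove_aout dem_remove_aout.
- by move=> A AS A0 A1; right; rewrite deg_remove_aout dem_remove_aout; apply: lb.
Qed.

(** * Contraction of a set, and restriction to it *)

Section Contract.
Variables (G : network) (A : {set V}) (a0 : V).
Hypotheses (a0A : a0 \in A) (AS : A \subset verts G).

Definition collapse v := if v \in A then a0 else v.
Definition collapse_sum (g : V -> int) p := if p == a0 then \sum_(v in A) g v else g p.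
(** For B inside the contracted vertex set, where a0 represents A, this is the preimage of B under
    [collapse]. *)
Definition expand (B : {set V}) := if a0 \in B then B :|: A else B.

Definition contract :=
  Network (a0 |: (verts G :\: A)) (fun e => collapse (src G e))
    (fun e => collapse (tgt G e))
    (collapse_sum (rho G)) (collapse_sum (ain G)) (collapse_sum (aout G)).

Lemma sum_collapse g (B : {set V}) : B \subset verts contract ->
  \sum_(p in B) collapse_sum g p = \sum_(v in expand B) g v.
Proof.
move=> BS; rewrite /expand /collapse_sum; case: ifP => a0B; last first.
  by apply: eq_bigr => p pB; case: eqP => // e; rewrite -e pB in a0B.
rewrite (bigD1 a0) //= eqxx [in RHS](big_setID A) /=.
rewrite setIUl setIid (setUidPr (subsetIr _ _)); congr (_ + _).
under eq_bigr => p /andP[_ /negPf->] do [].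
apply: eq_bigl => p; rewrite !inE.
have := subsetP BS p; rewrite !inE.
by case: (eqVneq p a0) => [->|_]; rewrite ?a0A ?a0B //=; case: (p \in A); case: (p \in B) => //= ->.
Qed.

Lemma collapse_expand v (B : {set V}) : B \subset verts contract -> v \in verts G ->
  (collapse v \in B) = (v \in expand B).
Proof.
move=> BS vS; rewrite /collapse /expand.
have := subsetP BS v; rewrite !inE vS andbT.
case: (boolP (v \in A)) => vA; case: (boolP (a0 \in B)) => a0B; rewrite ?inE ?vA ?orbT ?orbF //=;
  last by rewrite (negPf vA) orbF.
by case: (boolP (v \in B)) => // vB /(_ isT); case: eqP a0B => // <-; rewrite vB.
Qed.

Hypothesis src_S : forall e, src G e \in verts G.
Hypothesis tgt_S : forall e, tgt G e \in verts G.

Lemma deg_contract (B : {set V}) : B \subset verts contract -> deg contract B = deg G (expand B).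
Proof.
move=> BS; rewrite /deg; congr (_ + _).
  by apply: eq_bigr => e _ /=; rewrite !collapse_expand.
by rewrite big_split /= !sum_collapse // -big_split.
Qed.

Lemma dem_contract (B : {set V}) : B \subset verts contract -> dem contract B = dem G (expand B).
Proof.
by move=> BS; rewrite /dem sumrB big_split /= !sum_collapse // -big_split -sumrB.
Qed.

Lemma outflow_contract o (B : {set V}) : B \subset verts contract ->
  outflow (src contract) (tgt contract) o B = outflow (src G) (tgt G) o (expand B).
Proof. by move=> BS; apply: eq_bigr => e _ /=; rewrite !collapse_expand. Qed.

Lemma expand_sub (B : {set V}) : B \subset verts contract -> expand B \subset verts G.
Proof.
move=> BS; have BS' : B \subset verts G.
  apply: subset_trans BS _; rewrite subUset sub1set (subsetP AS) //.
  exact: subsetDl.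
by rewrite /expand; case: ifP => // _; rewrite subUset BS'.
Qed.

Lemma expand_verts : expand (verts contract) = verts G.
Proof.
rewrite /expand !inE eqxx /=; apply/setP => v; rewrite !inE.
by case: (boolP (v \in A)) => [/(subsetP AS)->|vA]; rewrite ?orbT //= orbF; case: eqP vA => // ->; rewrite a0A.
Qed.

Lemma expand_proper (B : {set V}) : B \subset verts contract ->
  expand B = verts G -> B = verts contract.
Proof.
move=> BS h; have a0S : a0 \in expand B by rewrite h (subsetP AS).
apply/eqP; rewrite eqEsubset BS /=; apply/subsetP => p.
move: a0S h; rewrite /expand; case: ifP => [a0B _ h|-> //].
rewrite !inE => /orP[/eqP-> //|/andP[pA]]; rewrite -h !inE (negPf pA); by rewrite orbF.
Qed.

(** Cuts of the contraction are cuts of G with the same degree and demand. If [expand B] is the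
    exempt singleton, it is too small to contain A, so it equals B. *)
Lemma admissible_contract x1 : (1 < #|A|)%N -> admissible G x1 -> admissible contract x1.
Proof.
move=> A1 aG; split=> //=.
- move=> e; have := src_S e; rewrite /collapse !inE.
  by case: ifP => [_|->]; rewrite ?eqxx // => ->; rewrite orbT.
- move=> e; have := tgt_S e; rewrite /collapse !inE.
  by case: ifP => [_|->]; rewrite ?eqxx // => ->; rewrite orbT.
- by move=> x; rewrite /collapse_sum; case: ifP => _; rewrite ?(ain_ge0 aG) // sumr_ge0 // => v _; apply: ain_ge0 aG _.
- by move=> x; rewrite /collapse_sum; case: ifP => _; rewrite ?(aout_ge0 aG) // sumr_ge0 // => v _; apply: aout_ge0 aG _.
- by rewrite sum_collapse // expand_verts; apply: rho_sum aG.
- move=> B BS; rewrite deg_contract // dem_contract //; apply: deg_dem aG _ _.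
  exact: expand_sub.
- by rewrite deg_contract // dem_contract // expand_verts; apply: deg_ub aG.
- move=> B BS B0 B1; rewrite deg_contract // dem_contract //.
  have e0 : expand B != set0.
    have [p pB] := set0Pn _ B0; apply/set0Pn; exists p.
    by rewrite /expand; case: ifP; rewrite ?inE pB.
  have e1 : expand B != verts G.
    by apply: contra_neq B1; apply: expand_proper.
  case: (deg_lb aG (expand_sub BS) e0 e1) => [[e n0]|]; [left | by right].
  split=> //; move: e; rewrite /expand; case: ifP => // a0B e.
  have := subset_leq_card (subsetUr B A); rewrite e cards1; lia.
Qed.

Lemma card_contract : (1 < #|A|)%N -> (#|verts contract| < #|verts G|)%N.
Proof.
move=> A1; apply: proper_card; apply/properP; split.
  by rewrite subUset sub1set (subsetP AS) // subsetDl.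
have /set0Pn[a] : A :\ a0 != set0 by rewrite -card_gt0; move: A1; rewrite (cardsD1 a0) a0A.
rewrite !inE => /andP[aa0 aA]; exists a; first exact: (subsetP AS).
by rewrite !inE (negPf aa0) aA.
Qed.

End Contract.

Section Restrict.
Variables (G : network) (A : {set V}) (a0 : V) (o : E -> bool).
Hypothesis a0A : a0 \in A.

Let inside e := (src G e \in A) && (tgt G e \in A).
Let tail e := if o e then src G e else tgt G e.
Let head e := if o e then tgt G e else src G e.

(* The edges leaving A, oriented by o, become arcs to and from z0. *)
Definition restrict :=
  Network A (fun e => if inside e then src G e else a0)
    (fun e => if inside e then tgt G e else a0)
    (fun v => rho G v - \sum_(e | ~~ inside e) ((tail e == v)%:Z - (head e == v)%:Z))
    (fun v => ain G v + \sum_(e | ~~ inside e) (head e == v)%:Z)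
    (fun v => aout G v + \sum_(e | ~~ inside e) (tail e == v)%:Z).

Lemma sum_eq_mem (B : {set V}) p : \sum_(x in B) (p == x)%:Z = (p \in B)%:Z.
Proof.
rewrite -[RHS]mul1r -sum_delta; apply: eq_bigr => x _.
by rewrite mul1r eq_sym.
Qed.

Lemma deg_restrict (B : {set V}) : B \subset A -> deg restrict B = deg G B.
Proof.
move=> BA; rewrite /deg /cut /= [in RHS](bigID inside) /= (bigID inside) /=.
rewrite [X in _ + X + _]big1 ?addr0; last by move=> e /negPf->; rewrite addbb.
rewrite -addrA; congr (_ + _).
  by apply: eq_bigr => e ->.
rewrite (eq_bigr (fun x => (ain G x + aout G x) + (\sum_(e | ~~ inside e) (head e == x)%:Z
  + \sum_(e | ~~ inside e) (tail e == x)%:Z))); last by move=> x _; rewrite addrACA.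
rewrite big_split /= addrC; congr (_ + _).
rewrite big_split /= [X in X + _]exchange_big [X in _ + X]exchange_big -big_split /=.
apply: eq_bigr => e; rewrite !sum_eq_mem /tail /head /inside => ne.
have hs : src G e \in B -> src G e \in A by apply: (subsetP BA).
have ht : tgt G e \in B -> tgt G e \in A by apply: (subsetP BA).
by case: (o e); case: (src G e \in B) hs ne => [/(_ isT)->|_];
  case: (tgt G e \in B) ht => [/(_ isT)->|_].
Qed.

Lemma dem_restrict (B : {set V}) : dem restrict B = dem G B.
Proof.
apply: eq_bigr => x _ /=; rewrite sumrB.
by set p := \sum_(e | _) _; set q := \sum_(e | _) _; lia.
Qed.

Lemma outflow_restrict o2 (B : {set V}) :
  outflow (src G) (tgt G) (fun e => if inside e then o2 e else o e) B
  = outflow (src restrict) (tgt restrict) o2 B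
    + \sum_(e | ~~ inside e) ((tail e \in B)%:Z - (head e \in B)%:Z).
Proof.
rewrite /outflow /= [in LHS](bigID inside) /= [in RHS](bigID inside) /=.
rewrite [X in _ = _ + X + _]big1 ?addr0; last by move=> e /negPf->; rewrite subrr mulr0.
congr (_ + _); apply: eq_bigr => e h; rewrite ?h ?(negPf h) //.
by rewrite /tail /head; case: (o e); rewrite /sg ?mul1r ?mulN1r ?opprB.
Qed.

Lemma outflow_outside : outflow (src G) (tgt G) o A =
  \sum_(e | ~~ inside e) ((tail e \in A)%:Z - (head e \in A)%:Z).
Proof.
rewrite /outflow (bigID inside) /= big1 ?add0r; last first.
  by move=> e /andP[-> ->]; rewrite subrr mulr0.
apply: eq_bigr => e _.
by rewrite /tail /head; case: (o e); rewrite /sg ?mul1r ?mulN1r ?opprB.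
Qed.

Lemma rho_restrict : \sum_(x in A) rho restrict x
  = \sum_(x in A) rho G x - outflow (src G) (tgt G) o A.
Proof.
rewrite outflow_outside /= sumrB exchange_big /=; congr (_ - _).
by apply: eq_bigr => e _; rewrite sumrB !sum_eq_mem.
Qed.

(** Subsets of A keep degree and demand, so the lower bounds are inherited. Tightness of A is the
    upper bound at the new z0, and the assumption on the outflow of A makes the new [rho] sum to 0
    modulo 2m. *)
Lemma admissible_restrict x1 : admissible G x1 -> A \subset verts G -> A != verts G ->
  deg G A <= 2 * m - 2 + N (dem G A) ->
  eqmod m (outflow (src G) (tgt G) o A) (\sum_(x in A) rho G x) ->
  admissible restrict x1.
Proof.
move=> aG AS AnS tight [j hj].
split=> /=.
- by move=> e; case: ifP => // /andP[].
- by move=> e; case: ifP => // /andP[].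
- by move=> x; rewrite addr_ge0 ?(ain_ge0 aG) // sumr_ge0.
- by move=> x; rewrite addr_ge0 ?(aout_ge0 aG) // sumr_ge0.
- by exists (- j); rewrite -[LHS]/(\sum_(x in A) rho restrict x) rho_restrict hj; lia.
- move=> B BA; rewrite deg_restrict // dem_restrict; apply: deg_dem aG _ _.
  exact: subset_trans AS.
- by rewrite deg_restrict // dem_restrict.
- move=> B BA B0 B1; rewrite deg_restrict // dem_restrict; apply: deg_lb aG _ _ B0 _.
    exact: subset_trans AS.
  apply: contraNneq B1 => eB; rewrite eqEsubset BA eB AS //.
Qed.

End Restrict.

(** A solution with A contracted orients the edges leaving A. They become the arcs at z0 of the
    problem inside A, and the two solutions agree on them. *)
Lemma solvable_tight (G : network) x1 (A : {set V}) : admissible G x1 ->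
  (forall (G' : network) x1', admissible G' x1' -> smaller G' G -> solvable G') ->
  A \subset verts G -> (1 < #|A|)%N -> A != verts G ->
  deg G A < 2 * m + N (dem G A) -> solvable G.
Proof.
move=> aG IH AS A1 AnS tight0.
(* Both sides have the same parity, so the strict bound improves by 2. *)
have tight : deg G A <= 2 * m - 2 + N (dem G A).
  have [j hj] := deg_dem aG AS; have [i hi] := dist_mod_parity m_gt0 (dem G A); lia.
have [a0 a0A] : exists a0, a0 \in A by apply/card_gt0P; lia.
have [o1 ho1] : solvable (contract G A a0).
  apply: (IH _ x1); first by apply: admissible_contract => //; case: aG.
  by left; apply: card_contract.
(* This is the congruence that o1 satisfies at the contracted vertex a0. *)
have hA : eqmod m (outflow (src G) (tgt G) o1 A) (\sum_(x in A) rho G x).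
  have a0S : a0 \in verts (contract G A a0) by rewrite !inE eqxx.
  have := ho1 a0 a0S; rewrite outflow_contract ?sub1set //; try by case: aG.
  rewrite /expand inE eqxx (setUidPr _) ?sub1set //.
  by rewrite /= /collapse_sum eqxx.
have [o2 ho2] : solvable (restrict G A a0 o1).
  apply: (IH _ x1); first exact: admissible_restrict.
  by left; apply: proper_card; rewrite properEneq AnS.
pose inside e := (src G e \in A) && (tgt G e \in A).
exists (fun e => if inside e then o2 e else o1 e) => v vS.
have [vA|vA] := boolP (v \in A).
  rewrite [outflow _ _ _ _](@outflow_restrict G A a0 o1 o2) /=.
  have [j hj] := ho2 v vA; exists j; rewrite hj /=.
  have -> : \sum_(e | ~~ inside e) (((if o1 e then src G e else tgt G e) \in [set v])%:Z
     - ((if o1 e then tgt G e else src G e) \in [set v])%:Z) =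
    \sum_(e | ~~ inside e) (((if o1 e then src G e else tgt G e) == v)%:Z
     - ((if o1 e then tgt G e else src G e) == v)%:Z).
    by apply: eq_bigr => e _; rewrite !inE.
  by rewrite /inside addrAC subrK.
have va0 : v != a0 by apply: contraNneq vA => ->.
have vS' : v \in verts (contract G A a0) by rewrite !inE vA vS orbT.
have [j] := ho1 v vS'; rewrite outflow_contract ?sub1set //; try by case: aG.
rewrite /expand inE eq_sym (negPf va0) /= /collapse_sum (negPf va0) => hj.
exists j; rewrite -hj; apply: eq_bigr => e _; rewrite !inE.
case: ifP => // /andP[sA tA].
have -> : (src G e == v) = false by apply: contraNF vA => /eqP <-.
have -> : (tgt G e == v) = false by apply: contraNF vA => /eqP <-.
by rewrite !mulr0.
Qed.

(** * Removing a vertex of zero demand *)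

Lemma subset_of_card (T : finType) (F : {set T}) n : (n <= #|F|)%N ->
  exists2 F1 : {set T}, F1 \subset F & #|F1| = n.
Proof.
move=> nF; exists [set e in take n (enum F)].
  by apply/subsetP => e; rewrite inE => /mem_take; rewrite mem_enum.
rewrite cardsE (card_uniqP _) ?take_uniq ?enum_uniq // size_take -cardE.
by case: ltngtP nF.
Qed.

Lemma dem1 (G : network) x : dem G [set x] = rho G x + aout G x - ain G x.
Proof. by rewrite /dem big_set1. Qed.

Lemma sumD1 (S : {set V}) x (g : V -> int) : x \in S ->
  \sum_(v in S) g v = g x + \sum_(v in S :\ x) g v.
Proof.
by move=> xS; rewrite (bigD1 x) //=; congr (_ + _); apply: eq_bigl => v; rewrite !inE andbC.
Qed.

Section ZeroDemand.
Variables (G : network) (x : V).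
Hypotheses (aG : admissible G x) (xS : x \in verts G).
Hypothesis IH : forall (G' : network) x1', admissible G' x1' -> smaller G' G -> solvable G'.
Hypothesis sG : slack G.
Hypothesis x0 : N (dem G [set x]) = 0.

Lemma joins_in e u v : joins G e u v -> (u \in verts G) && (v \in verts G).
Proof.
have := src_in aG e; have := tgt_in aG e.
by move=> h1 h2 /orP[] /andP[/eqP<- /eqP<-]; rewrite h1 h2.
Qed.

(** Splitting off at x costs a cut at most 2, which nontrivial cuts can afford and the exempt cut
    around x may lose. A singleton other than x has no slack, so it must lose nothing. *)
Lemma zero_lb (A : {set V}) : A \subset verts G -> A != set0 -> A != verts G ->
  [\/ A = [set x], 2 * m + N (dem G A) <= deg G A |
    exists w, [/\ w != x, A = [set w] & 2 * m - 2 + N (dem G A) <= deg G A]].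
Proof.
move=> AS A0 A1.
have [c1|] := ltnP 1 #|A|; first by apply: Or32; apply: sG.
move=> c1; have /cards1P[w eA] : #|A| == 1%N by rewrite eqn_leq c1 card_gt0.
have [ew|nw] := eqVneq w x; first by apply: Or31; rewrite eA ew.
apply: Or33; exists w; split=> //.
case: (deg_lb aG AS A0 A1) => // -[e _]; move: e; rewrite eA => /set1_inj e.
by rewrite e eqxx in nw.
Qed.

(** Because u and v differ, the new edge is no loop and every vertex other than x keeps its
    degree. *)
Lemma solvable_zero_lift e1 e2 u v : joins G e1 u x -> joins G e2 x v ->
  u != x -> v != x -> u != v -> solvable G.
Proof.
move=> e1ux e2xv ux vx uv.
have /andP[uS _] := joins_in e1ux; have /andP[_ vS] := joins_in e2xv.
have e12 : e1 != e2.
  apply/eqP => e; move: e1ux e2xv; rewrite /joins -e.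
  move=> /orP[]/andP[/eqP-> /eqP->]; rewrite ?[x == u]eq_sym ?(negPf ux) ?(negPf uv) ?eqxx ?andbF ?orbF //.
apply: (solvable_lift_edges e1ux e2xv e12); apply: (IH (x1' := x)).
  apply: (admissible_lift_edges e1ux e2xv e12 aG).
    by rewrite (deg_lift_edges e1ux) // uS xS vS /=; have := deg_ub aG; lia.
  move=> A AS A0 A1; rewrite (deg_lift_edges e1ux) //.
  case: (zero_lb AS A0 A1) => [e|h|[w [wx eA h]]].
  - by left; rewrite e.
  - by right; move: h; clear; case: (u \in A); case: (x \in A); case: (v \in A); lia.
  - right; move: h; rewrite eA !inE [x == w]eq_sym (negPf wx).
    case: (eqVneq u w) => [e|_]; case: (eqVneq v w) => [e'|_] /=; try by (clear; lia).
    by rewrite e e' eqxx in uv.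
by right; split=> //; left; apply: (nonloops_lift_edges e1ux e2xv e12 ux); rewrite eq_sym.
Qed.

(** Splitting off an edge with an arc at z0: the path from z0 through x to u becomes an arc from z0
    to u, and no demand changes. *)
Lemma solvable_zero_ain e u : joins G e x u -> u != x -> 0 < ain G x -> solvable G.
Proof.
move=> exu ux ax; have /andP[_ uS] := joins_in exu; have xu : x != u by rewrite eq_sym.
apply: (solvable_orient_edge (ax := -1) (ay := 1) (bx := 0) (by_ := 0) exu).
apply: (IH (x1' := x)); last first.
  by right; split=> //; left; apply: nonloops_orient_edge.
apply: admissible_orient_edge aG _ _ _ _ _ _ => //.
- lia.
- have := ain_ge0 aG u; lia.
- have := aout_ge0 aG x; lia.
- have := aout_ge0 aG u; lia.
- by rewrite deg_orient_edge // dem_orient_edge // xS uS /= ?addr0; have := deg_ub aG; lia.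
move=> A AS A0 A1.
rewrite deg_orient_edge // dem_orient_edge //.
rewrite (_ : dem G A + _ + _ = dem G A); last by clear; lia.
case: (zero_lb AS A0 A1) => [e1|h|[w [wx eA h]]].
- by left; rewrite e1.
- by right; move: h; clear; case: (u \in A); case: (x \in A) => /=; lia.
- right; move: h; rewrite eA !inE [x == w]eq_sym (negPf wx).
  by clear; case: (u == w) => /=; lia.
Qed.

Lemma solvable_zero_aout e u : joins G e u x -> u != x -> 0 < aout G x -> solvable G.
Proof.
move=> eux ux ax; have /andP[uS _] := joins_in eux.
apply: (solvable_orient_edge (ax := 0) (ay := 0) (bx := 1) (by_ := -1) eux).
apply: (IH (x1' := x)); last first.
  by right; split=> //; left; apply: nonloops_orient_edge.
apply: admissible_orient_edge aG _ _ _ _ _ _ => //.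
- have := ain_ge0 aG u; lia.
- have := ain_ge0 aG x; lia.
- have := aout_ge0 aG u; lia.
- lia.
- by rewrite deg_orient_edge // dem_orient_edge // xS uS /= ?addr0; have := deg_ub aG; lia.
move=> A AS A0 A1.
rewrite deg_orient_edge // dem_orient_edge //.
rewrite (_ : dem G A + _ + _ = dem G A); last by clear; lia.
case: (zero_lb AS A0 A1) => [e1|h|[w [wx eA h]]].
- by left; rewrite e1.
- by right; move: h; clear; case: (u \in A); case: (x \in A) => /=; lia.
- right; move: h; rewrite eA !inE [x == w]eq_sym (negPf wx).
  by clear; case: (u == w) => /=; lia.
Qed.

(** All edges leaving x lead to u. Their number is even, as the demand of x is; half are directed
    out of x and half into it. All other edges follow a solution with x contracted into u. *)
Lemma solvable_zero_pendant u : u \in verts G -> u != x ->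
  ain G x = 0 -> aout G x = 0 ->
  (forall e w, joins G e x w -> w = x \/ w = u) -> solvable G.
Proof.
move=> uS ux ax bx nbr.
have xu : (x == u) = false by rewrite eq_sym (negPf ux).
pose A := [set x; u].
have AS : A \subset verts G by rewrite subUset !sub1set xS.
have A1 : (1 < #|A|)%N by rewrite cards2 xu.
have uA : u \in A by rewrite !inE eqxx orbT.
have [o1 ho1] : solvable (contract G A u).
  apply: (IH (x1' := x)); first by apply: admissible_contract => //; case: aG.
  by left; apply: card_contract.
pose F := [set e | joins G e x u].
have incid e : e \notin F -> (src G e == x) = (tgt G e == x).
  rewrite inE => eF; case: (eqVneq (src G e) x) => [es|ns].
    case: (nbr e (tgt G e)); first by rewrite /joins es !eqxx.
      by move->; rewrite eqxx.
    by move=> et; rewrite /joins es et !eqxx in eF.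
  case: (eqVneq (tgt G e) x) => // et.
  case: (nbr e (src G e)); first by rewrite /joins et !eqxx orbT.
    by move=> es; rewrite es eqxx in ns.
  by move=> es; rewrite /joins es et !eqxx orbT in eF.
have rx : eqmod m (rho G x) 0.
  by have := dist_mod0 m_gt0 x0; rewrite dem1 ax bx addr0 subr0.
have [n hn] : exists n, #|F| = (n + n)%N.
  have sx : [set x] \subset verts G by rewrite sub1set.
  have [j hj] := deg_dem aG sx.
  have hF : deg G [set x] = #|F|%:Z.
    rewrite /deg big_set1 ax bx !addr0 /cut -sum1_card (big_morph Posz PoszD erefl).
    rewrite [in RHS]big_mkcond /=; apply: eq_bigr => e _; rewrite !in_set1.
    case: (boolP (e \in F)) => [|/incid->]; last by rewrite addbb.
    by rewrite inE /joins => /orP[]/andP[/eqP-> /eqP->]; rewrite !eqxx (negPf ux).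
  rewrite hF dem1 ax bx in hj; case: rx => i hi.
  by exists (absz (j + i * m)); lia.
have [F1 F1F cF1] := @subset_of_card _ F n ltac:(lia).
(* Edges of F1 leave x and those of F outside F1 enter it, whichever end is the source. *)
pose o e := if e \in F then (e \in F1) == (src G e == x) else o1 e.
have flow_x : outflow (src G) (tgt G) o [set x] = 0.
  rewrite /outflow (bigID (mem F)) /= [X in _ + X]big1 ?addr0; last first.
    by move=> e /incid; rewrite !inE => ->; rewrite subrr mulr0.
  rewrite (bigID (mem F1)) /= (eq_bigr (fun=> 1)); last first.
    move=> e /andP[eF eF1]; rewrite /o eF eF1 !inE.
    by move: eF; rewrite inE => /orP[]/andP[/eqP-> /eqP->]; rewrite !eqxx (negPf ux).
  rewrite [X in _ + X](eq_bigr (fun=> -1)); last first.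
    move=> e /andP[eF /negPf eF1]; rewrite /o eF eF1 !inE.
    by move: eF; rewrite inE => /orP[]/andP[/eqP-> /eqP->]; rewrite !eqxx (negPf ux).
  rewrite sumrN !sumr_const.
  have -> : #|[pred e | e \in F & e \in F1]| = n.
    by rewrite -cF1; apply: eq_card => e; rewrite inE; case: (boolP (e \in F1)) => [/(subsetP F1F)->|]; rewrite ?andbF.
  have : #|[pred e | e \in F & e \notin F1]| = (#|F| - n)%N.
    rewrite -cF1 -(cardsID F1 F) (setIidPr F1F) addKn -cardsE.
    by apply: eq_card => e; rewrite !inE andbC.
  by move->; rewrite hn addnK subrr.
have flow_same (B : {set V}) : (x \in B) = (u \in B) ->
    outflow (src G) (tgt G) o B = outflow (src G) (tgt G) o1 B.
  move=> xuB; apply: eq_bigr => e _; rewrite /o; case: ifP => // eF.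
  move: eF; rewrite inE => /orP[]/andP[/eqP-> /eqP->]; by rewrite xuB subrr !mulr0.
have flow_A : eqmod m (outflow (src G) (tgt G) o1 A) (rho G x + rho G u).
  have := ho1 u; rewrite !inE eqxx => /(_ isT).
  rewrite outflow_contract ?sub1set //; try by case: aG.
    rewrite /expand inE eqxx (setUidPr _) ?sub1set //= /collapse_sum eqxx.
    by rewrite big_setU1 ?inE ?xu // big_set1.
  by rewrite !inE eqxx.
exists o => v vS.
have [->|vx] := eqVneq v x.
  by rewrite flow_x; case: rx => j ->; exists (- j); lia.
have [->|vu] := eqVneq v u.
  have : outflow (src G) (tgt G) o A = outflow (src G) (tgt G) o [set x] +
      outflow (src G) (tgt G) o [set u].
    rewrite /outflow -big_split /=; apply: eq_bigr => e _; rewrite !inE.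
    rewrite -mulrDr; congr (_ * _).
    have h w : ((w == x) || (w == u))%:Z = (w == x)%:Z + (w == u)%:Z.
      by case: (eqVneq w x) => [->|_]; rewrite ?xu.
    by rewrite !h addrACA opprD.
  rewrite flow_same ?inE ?eqxx ?orbT // flow_x add0r => <-.
  case: rx => i hi; case: flow_A => j hj; exists (j + i); rewrite hj hi; lia.
rewrite flow_same ?inE; last by rewrite [x == v]eq_sym [u == v]eq_sym (negPf vx) (negPf vu).
have vS' : v \in verts (contract G A u) by rewrite !inE (negPf vx) (negPf vu) vS.
have := ho1 v vS'; rewrite outflow_contract ?sub1set //; try by case: aG.
by rewrite /expand inE eq_sym (negPf vu) /= /collapse_sum (negPf vu).
Qed.

Lemma solvable_zero : (1 < #|verts G|)%N -> solvable G.
Proof.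
move=> S1.
have joinsC e u v : joins G e u v = joins G e v u by rewrite /joins orbC.
have [/existsP[e1 /existsP[u /andP[e1xu ux]]]|none] :=
  boolP [exists e, [exists u, joins G e x u && (u != x)]].
  have /andP[_ uS] := joins_in e1xu.
  have [ax|ax] := ltP 0 (ain G x); first exact: solvable_zero_ain e1xu ux ax.
  have [bx|bx] := ltP 0 (aout G x).
    by apply: solvable_zero_aout ux bx; rewrite joinsC; apply: e1xu.
  have [/existsP[e2 /existsP[v /and3P[e2xv vx uv]]]|one] :=
    boolP [exists e, [exists v, [&& joins G e x v, v != x & u != v]]].
    by apply: solvable_zero_lift e2xv ux vx uv; rewrite joinsC; apply: e1xu.
  apply: solvable_zero_pendant uS ux _ _ _.
  - by have := ain_ge0 aG x; lia.
  - by have := aout_ge0 aG x; lia.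
  move=> e w exw; have [|wx] := eqVneq w x; [by left | right].
  apply/eqP; apply: contraNT one => uw; apply/existsP; exists e; apply/existsP; exists w.
  by rewrite exw wx eq_sym.
have nbr e w : joins G e x w -> w = x.
  move=> h; apply/eqP; apply: contraNT none => wx.
  by apply/existsP; exists e; apply/existsP; exists w; rewrite h.
(* Without edges at x, the lower bound on its complement and the upper bound at z0 leave no room for
   arcs between x and z0. Then any other vertex can serve as u. *)
pose A := verts G :\ x.
have A0 : A != set0 by rewrite -card_gt0; move: S1; rewrite (cardsD1 x) xS.
have A1 : A != verts G by apply/eqP => e; move: xS; rewrite -e !inE eqxx.
have lbA : 2 * m - 2 + N (dem G A) <= deg G A.
  case: (deg_lb aG (subsetDl _ _) A0 A1) => // -[e _].
  by have := set11 x; rewrite -e !inE eqxx.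
have cA : cut (src G) (tgt G) A = 0.
  rewrite /cut big1 // => e _; rewrite !inE (src_in aG) (tgt_in aG) !andbT.
  case: (eqVneq (src G e) x) => [es|ns]; case: (eqVneq (tgt G e) x) => [et|nt] //.
    by move: nt; rewrite (nbr e (tgt G e)) ?eqxx // /joins es !eqxx.
  by move: ns; rewrite (nbr e (src G e)) ?eqxx // /joins et !eqxx orbT.
have ub := deg_ub aG; rewrite /deg (cut_verts aG) (sumD1 _ xS) in ub.
rewrite /deg cA in lbA.
have dS : dem G (verts G) = dem G [set x] + dem G A by rewrite dem1 /dem (sumD1 _ xS).
have := dist_modD m_gt0 (dem G [set x]) (dem G A); rewrite -dS x0.
have := ain_ge0 aG x; have := aout_ge0 aG x => b0 a0 nS.
have [u uA] := set0Pn _ A0; move: uA; rewrite !inE => /andP[ux uS].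
have [ax bx] : ain G x = 0 /\ aout G x = 0.
  by move: ub lbA; rewrite -/A; set s := \sum_(v in A) _ => ub lbA; split; lia.
by apply: solvable_zero_pendant uS ux ax bx _ => e w /nbr; left.
Qed.

End ZeroDemand.

(** * All demands nonzero *)

Lemma admissible_strong (G : network) x1 (A : {set V}) : admissible G x1 ->
  ~~ ((x1 \in verts G) && (N (dem G [set x1]) == 0)) ->
  A \subset verts G -> A != set0 -> A != verts G -> 2 * m - 2 + N (dem G A) <= deg G A.
Proof.
move=> aG h AS A0 A1; case: (deg_lb aG AS A0 A1) => // -[e n0].
by move: h AS; rewrite -e n0 eqxx andbT e sub1set => /negPf->.
Qed.

(** Here q lies above a nearest multiple of 2m, so decreasing it leads towards that multiple. *)
Lemma dist_mod_dec p q : eqmod m q (N q) -> 0 < N q -> p = q - 1 -> N p <= N q - 1.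
Proof.
case=> j; set a := N q => e a0 ep.
have := @dist_mod_le m m_gt0 p (a - 1) ltac:(exists j; lia); lia.
Qed.

Lemma dist_mod_inc p q : eqmod m q (- N q) -> 0 < N q -> p = q + 1 -> N p <= N q - 1.
Proof.
case=> j; set a := N q => e a0 ep.
have := @dist_mod_le m m_gt0 p (1 - a) ltac:(exists j; lia); lia.
Qed.

Section NonzeroDemand.
Variables (G : network) (x1 : V).
Hypothesis aG : admissible G x1.
Hypothesis IH : forall (G' : network) x1', admissible G' x1' -> smaller G' G -> solvable G'.
Hypothesis sG : slack G.
Hypothesis S1 : (1 < #|verts G|)%N.
Hypothesis nz : forall x, x \in verts G -> 0 < N (dem G [set x]).

Lemma nonzero_strong (A : {set V}) : A \subset verts G -> A != set0 -> A != verts G ->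
  2 * m - 2 + N (dem G A) <= deg G A.
Proof.
apply: admissible_strong aG _; apply/negP => /andP[/nz h /eqP e].
by rewrite e in h.
Qed.

Lemma nonzero_lb (A : {set V}) : A \subset verts G -> A != set0 -> A != verts G ->
  2 * m + N (dem G A) <= deg G A \/
  exists w, [/\ w \in verts G, A = [set w] & 2 * m - 2 + N (dem G A) <= deg G A].
Proof.
move=> AS A0 A1.
have [c1|] := ltnP 1 #|A|; first by left; apply: sG.
move=> c1; have /cards1P[w eA] : #|A| == 1%N by rewrite eqn_leq c1 card_gt0.
right; exists w; split=> //; last exact: nonzero_strong.
by rewrite -sub1set -eA.
Qed.

(** Otherwise the degrees of A and its complement add up to that of z0. Their two lower bounds then
    exceed the upper bound at z0 by at least 2m - 2 > 0, by subadditivity of N. *)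
Lemma cross_edge (A : {set V}) : A \subset verts G -> A != set0 -> A != verts G ->
  exists e x y, [/\ joins G e x y, x \in A & y \in verts G :\: A].
Proof.
move=> AS A0 A1; pose B := verts G :\: A.
have BS : B \subset verts G by apply: subsetDl.
have B0 : B != set0 by rewrite setD_eq0; apply: contraNN A1 => h; rewrite eqEsubset AS.
have B1 : B != verts G.
  apply: contraNneq A0 => eB; apply/eqP/setP => v; rewrite inE.
  by apply/negP => vA; have := subsetP AS v vA; rewrite -eB !inE vA.
have [/existsP[e he]|none] := boolP [exists e, (src G e \in A) (+) (tgt G e \in A)].
  exists e; have sS := src_in aG e; have tS := tgt_in aG e.
  move: he; case: (boolP (src G e \in A)) => sA; case: (boolP (tgt G e \in A)) => tA //= _.
    by exists (src G e), (tgt G e); rewrite /joins !eqxx inE tA tS sA.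
  by exists (tgt G e), (src G e); rewrite /joins !eqxx orbT inE sA sS tA.
have cutA e : (src G e \in A) (+) (tgt G e \in A) = false.
  by apply: contraNF none => h; apply/existsP; exists e.
have cA : cut (src G) (tgt G) A = 0 by rewrite /cut big1 // => e _; rewrite cutA.
have cB : cut (src G) (tgt G) B = 0.
  rewrite /cut big1 // => e _; rewrite !inE (src_in aG) (tgt_in aG) !andbT.
  by have := cutA e; case: (_ \in A); case: (_ \in A).
have := nonzero_strong AS A0 A1; have := nonzero_strong BS B0 B1; have := deg_ub aG.
have dS : dem G (verts G) = dem G A + dem G B.
  by rewrite /dem (big_setID A) /= (setIidPr AS).
have eS : deg G (verts G) = deg G A + deg G B.
  by rewrite /deg (cut_verts aG) cA cB !add0r (big_setID A) /= (setIidPr AS).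
have := dist_modD m_gt0 (dem G A) (dem G B); rewrite -dS eS.
by move=> h1 h2 h3 h4; exfalso; lia.
Qed.

(** Directing e from x to y brings both demands one closer to 0, which pays for the lost degree at x
    and y. A nontrivial cut loses at most 1 in degree and gains at most 1 in distance, within its
    slack. *)
Lemma solvable_opposite e x y : joins G e x y -> x != y ->
  eqmod m (dem G [set x]) (N (dem G [set x])) ->
  eqmod m (dem G [set y]) (- N (dem G [set y])) -> solvable G.
Proof.
move=> exy xy dnx upy.
have /andP[xS yS] := joins_in aG exy.
apply: (solvable_orient_edge (ax := 0) (ay := 0) (bx := 0) (by_ := 0) exy).
apply: (IH (x1' := x1)); last first.
  by right; split=> //; left; apply: nonloops_orient_edge.
apply: admissible_orient_edge aG _ _ _ _ _ _ => //; rewrite ?addr0;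
  try exact: ain_ge0 aG _; try exact: aout_ge0 aG _.
  rewrite deg_orient_edge // dem_orient_edge // xS yS /=; set r := dem G (verts G) + _ + _.
  have -> : r = dem G (verts G) by rewrite /r; clear; lia.
  by have := deg_ub aG; clear; lia.
move=> A AS A0 A1; right; rewrite deg_orient_edge // dem_orient_edge //.
set r := dem G A + _ + _.
have er : r - dem G A = (y \in A)%:Z - (x \in A)%:Z by rewrite /r; clear; lia.
case: (nonzero_lb AS A0 A1) => [h|[w [wS eA h]]].
  have := dist_mod_lip m_gt0 r (dem G A); rewrite er; move: h; clearbody r; clear.
  by case: (x \in A); case: (y \in A) => /=; lia.
have memA z : (z \in A) = (z == w) by rewrite eA inE.
rewrite !memA in er *.
have [ex|nx] := eqVneq x w; last have [ey|ny] := eqVneq y w.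
- have := dist_mod_dec (p := r) dnx (nz xS); rewrite ex -eA.
  move: er h; rewrite ex eqxx (_ : (y == w) = false) -?ex 1?eq_sym ?(negPf xy) //=.
  by clearbody r; clear => er h /(_ ltac:(lia)); lia.
- have := dist_mod_inc (p := r) upy (nz yS); rewrite ey -eA.
  move: er h; rewrite ey eqxx (negPf nx) /=.
  by clearbody r; clear => er h /(_ ltac:(lia)); lia.
move: er h; rewrite (negPf nx) (negPf ny) /=; clearbody r; clear => er.
by rewrite (_ : r = dem G A); lia.
Qed.

Hypothesis dn : forall x, x \in verts G -> eqmod m (dem G [set x]) (N (dem G [set x])).

Lemma dist_mod_dn (A : {set V}) x r : x \in verts G -> A = [set x] ->
  r = dem G A - 1 -> N r <= N (dem G A) - 1.
Proof. by move=> xS ->; apply: dist_mod_dec; [apply: dn | apply: nz]. Qed.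

(** At x, degree and distance both drop by 1. At z0 the degree drops by 1 and the distance by at
    most 1, and nontrivial cuts have slack 2. *)
Lemma solvable_remove_aout x : x \in verts G -> 0 < aout G x -> solvable G.
Proof.
move=> xS bx; suff: solvable (remove_aout G x) by [].
apply: (IH (x1' := x1)); last first.
  by right; split=> //; right; split=> //; rewrite deg_remove_aout /= xS; clear; lia.
apply: admissible_remove_aout aG bx _ _; rewrite ?xS.
  have := deg_ub aG; set r := dem G (verts G) - _; have er : dem G (verts G) - r = 1 by rewrite /r; clear; lia.
  by have := dist_mod_lip m_gt0 (dem G (verts G)) r; rewrite er; clearbody r; clear; lia.
move=> A AS A0 A1; set r := dem G A - _.
have er : r - dem G A = - (x \in A)%:Z by rewrite /r; clear; lia.
case: (nonzero_lb AS A0 A1) => [h|[w [wS eA h]]].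
  have := dist_mod_lip m_gt0 r (dem G A); rewrite er; move: h; clearbody r; clear.
  by case: (x \in A) => /=; lia.
have memA z : (z \in A) = (z == w) by rewrite eA inE.
rewrite !memA in er *.
have [ex|nx] := eqVneq x w.
  have := dist_mod_dn (r := r) wS eA; move: er h; rewrite ex eqxx.
  by clearbody r; clear => er h /(_ ltac:(lia)); lia.
move: er h; rewrite (negPf nx); clearbody r; clear => er.
by rewrite (_ : r = dem G A); lia.
Qed.

(* With every demand positive and every arc at z0 outgoing, z0 has at most
   2m - 1 arcs; either it can take one more, or its demand is -1 modulo 2m and
   the demand of x can be pushed past m. *)
Lemma solvable_positive : solvable G.
Proof.
have [/existsP[x /andP[xS bx]]|noout] := boolP [exists x, (x \in verts G) && (0 < aout G x)].
  exact: solvable_remove_aout xS bx.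
have aout0 x : x \in verts G -> aout G x = 0.
  move=> xS; have := aout_ge0 aG x; have [//|b0] := ltP 0 (aout G x).
    move=> bx; case/negP: noout; apply/existsP; exists x; by rewrite xS.
  by lia.
pose a := deg G (verts G).
have ea : a = \sum_(x in verts G) ain G x.
  rewrite /a /deg (cut_verts aG) add0r; apply: eq_bigr => x xS.
  by rewrite aout0 // addr0.
have da : eqmod m (dem G (verts G)) (- a).
  have [j hj] := rho_sum aG; exists j.
  rewrite /dem ea -sumrN (eq_bigr (fun x => rho G x + - ain G x)).
    by rewrite big_split /= hj add0r addrC.
  by move=> x xS; rewrite aout0 // addr0.
have a0 : 0 <= a by rewrite ea sumr_ge0 // => x _; apply: ain_ge0 aG _.
have ub := deg_ub aG; rewrite -/a in ub.
(* The demand of [verts] is congruent to 2m - a, so a >= 2m would turn the upper bound into a <= a -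
   2. *)
have a_le : a <= 2 * m - 1.
  have : N (dem G (verts G)) <= `|2 * m - a|.
    by apply: dist_mod_le => //; case: da => j ->; exists (j - 1); lia.
  by move: ub; set n := N _; lia.
have [x xS] : exists x, x \in verts G by apply/card_gt0P; lia.
have [e [x' [y [exy]]]] : exists e x' y, [/\ joins G e x' y, x' \in [set x] & y \in verts G :\: [set x]].
  apply: cross_edge; rewrite ?sub1set //; first by apply/set0Pn; exists x; rewrite inE.
  by apply: contraTneq S1 => <-; rewrite cards1.
rewrite !inE => /eqP ex' /andP[yx yS]; rewrite ex' in exy.
have [a_small|a_big] := leP a (2 * m - 2).
  have xy : x != y by rewrite eq_sym.
  (* An arc from z0 to y replaces the edge: y keeps degree and demand, while x loses one of each. *)
  apply: (solvable_orient_edge (ax := 0) (ay := 1) (bx := 0) (by_ := 0) exy).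
  apply: (IH (x1' := x1)); last first.
    by right; split=> //; left; apply: nonloops_orient_edge.
  apply: admissible_orient_edge aG _ _ _ _ _ _ => //; rewrite ?addr0;
    try exact: ain_ge0 aG _; try exact: aout_ge0 aG _.
  - by rewrite addr_ge0 // (ain_ge0 aG).
  - rewrite deg_orient_edge // dem_orient_edge // xS yS /= -/a.
    set r := dem G (verts G) + _ + _.
    have -> : N r = N (a + 1).
      rewrite -dist_modN //; apply: dist_mod_congr; rewrite /r; case: da => j ->.
      by exists (- j); lia.
    have [am|am] := leP (a + 1) m; first by rewrite dist_mod_small //; lia.
    have -> : N (a + 1) = N (2 * m - a - 1).
      rewrite -dist_modN //; apply: dist_mod_congr; exists (-1); lia.
    by rewrite dist_mod_small //; lia.
  move=> A AS A0 A1; right; rewrite deg_orient_edge // dem_orient_edge //.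
  set r := dem G A + _ + _.
  have er : r - dem G A = - (x \in A)%:Z by rewrite /r; clear; lia.
  case: (nonzero_lb AS A0 A1) => [h|[w [wS eA h]]].
    have := dist_mod_lip m_gt0 r (dem G A); rewrite er; move: h; clearbody r; clear.
    by case: (x \in A); case: (y \in A) => /=; lia.
  have memA z : (z \in A) = (z == w) by rewrite eA inE.
  rewrite !memA in er *.
  have [ex|nx] := eqVneq x w.
    have := dist_mod_dn (r := r) wS eA; move: er h; rewrite -ex eqxx (negPf yx).
    by clearbody r; clear => er h /(_ ltac:(lia)); lia.
  move: er h; rewrite (negPf nx); clearbody r; clear => er.
  by rewrite (_ : r = dem G A); [case: (y == w) => /=; lia | lia].
have {a_big a_le} ea' : a = 2 * m - 1 by lia.
pose t := N (dem G [set x]).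
have /andP[_ tm] : 0 <= t <= m by apply: dist_mod_bounds.
have t0 : 0 < t by apply: nz.
have eyx : joins G e y x by rewrite /joins orbC.
(* With m - t new arcs from x to z0 the demand t of x becomes m + 1, at distance m - 1, so its
   degree and distance both change by m - t - 1. At z0 the new degree 3m - 1 - t meets its upper
   bound with equality. *)
apply: (solvable_orient_edge (ax := 0) (ay := 0) (bx := 0) (by_ := m - t) eyx).
apply: (IH (x1' := x1)); last first.
  by right; split=> //; left; apply: nonloops_orient_edge.
apply: admissible_orient_edge aG _ _ _ _ _ _ => //; rewrite ?addr0;
  try exact: ain_ge0 aG _; try exact: aout_ge0 aG _.
- by have := aout_ge0 aG x; lia.
- rewrite deg_orient_edge // dem_orient_edge // xS yS /= -/a ea'.
  set r := dem G (verts G) + _ + _; have -> : N r = N (1 + m - t).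
    apply: dist_mod_congr; rewrite /r; case: da => j ->.
    by exists (j - 1); rewrite ea'; lia.
  by rewrite dist_mod_small; lia.
move=> A AS A0 A1; right; rewrite deg_orient_edge // dem_orient_edge //.
set r := dem G A + _ + _.
have er : r - dem G A = (m - t + 1) * (x \in A)%:Z - (y \in A)%:Z by rewrite /r; clear; lia.
case: (nonzero_lb AS A0 A1) => [h|[w [wS eA h]]].
  have := dist_mod_lip m_gt0 r (dem G A); rewrite er; move: h tm; clearbody r t; clear.
  by case: (x \in A); case: (y \in A) => /=; lia.
have memA z : (z \in A) = (z == w) by rewrite eA inE.
rewrite !memA in er *.
have [ex|nx] := eqVneq x w.
  have hr : N r <= `|1 - m|.
    apply: dist_mod_le => //; have [j hj] := dn xS; rewrite -/t in hj.
    move: er; rewrite eA -ex eqxx (negPf yx) hj; clear => er.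
    by exists (j + 1); lia.
  have et : N (dem G A) = t by rewrite eA -ex.
  move: h hr m_gt1 tm; rewrite et -ex ?eqxx (negPf yx) /=.
  by clearbody r t; clear; lia.
have [ey|ny] := eqVneq y w.
  have := dist_mod_dn (r := r) wS eA; move: er h; rewrite (negPf nx) ey eqxx.
  by clearbody r t; clear => er h /(_ ltac:(lia)); lia.
move: er h; rewrite (negPf nx) (negPf ny); clearbody r t; clear => er.
by rewrite (_ : r = dem G A); lia.
Qed.

End NonzeroDemand.

(** * The induction *)

Lemma solvable_step (G : network) x1 : admissible G x1 ->
  (forall (G' : network) x1', admissible G' x1' -> smaller G' G -> solvable G') -> solvable G.
Proof.
move=> aG IH.
have [S1|] := ltnP 1 #|verts G|; last first.
  rewrite leq_eqVlt => /orP[/cards1P[v eS]|]; last first.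
    rewrite ltnS leqn0 cards_eq0 => /eqP e; exists (fun=> true) => w.
    by rewrite e inE.
  exists (fun=> true) => w; rewrite eS inE => /eqP ->.
  have [j hj] := rho_sum aG; move: hj; rewrite eS big_set1 => ->.
  exists (- j); rewrite /outflow big1; first by lia.
  move=> e _; have := src_in aG e; have := tgt_in aG e; rewrite eS => -> ->.
  by rewrite subrr mulr0.
have [/existsP[A /and4P[AS A1 AnS tight]]|noA] := boolP [exists A : {set V},
  [&& A \subset verts G, (1 < #|A|)%N, A != verts G & deg G A < 2 * m + N (dem G A)]].
  exact: solvable_tight aG IH AS A1 AnS tight.
have sG : slack G.
  move=> A AS A1 AnS; rewrite leNgt; apply: contraNN noA => h; apply/existsP; exists A.
  by rewrite AS A1 AnS.
have [/andP[x1S /eqP z1]|nz1] := boolP ((x1 \in verts G) && (N (dem G [set x1]) == 0)).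
  exact: solvable_zero aG x1S IH sG z1 S1.
have strong := admissible_strong aG nz1.
have [/existsP[x /andP[xS /eqP xz]]|nz] := boolP [exists x, (x \in verts G) && (N (dem G [set x]) == 0)].
  (* No cut uses the exemption at this point, so it can be moved to x. *)
  have aG' : admissible G x.
    by case: (aG) => h1 h2 h3 h4 h5 h6 h7 _; split=> // A AS A0 A1; right; apply: strong.
  exact: solvable_zero aG' xS IH sG xz S1.
have {}nz x : x \in verts G -> 0 < N (dem G [set x]).
  move=> xS; have /andP[h _] := dist_mod_bounds m_gt0 (dem G [set x]).
  rewrite lt_neqAle h andbT eq_sym; apply: contraNN nz => h0.
  by apply/existsP; exists x; rewrite xS.
(* At distance m a demand has both signs; it is counted as positive. *)
pose pos x := (2 * m %| dem G [set x] - N (dem G [set x]))%Z.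
have posP x : pos x -> eqmod m (dem G [set x]) (N (dem G [set x])).
  by case/dvdzP => j hj; exists j; rewrite -hj addrC subrK.
have negP' x : ~~ pos x -> eqmod m (dem G [set x]) (- N (dem G [set x])).
  move=> h; case: (dist_mod_rep m_gt0 (dem G [set x])) => // -[j hj].
  by case/negP: h; apply/dvdzP; exists j; rewrite [X in X - _]hj addrC addKr.
pose P := [set x in verts G | pos x].
have PS : P \subset verts G by apply/subsetP => x; rewrite inE => /andP[].
have [P0|P0] := eqVneq P set0.
  apply: solvable_reverse; apply: (@solvable_positive _ x1) => //=.
  - exact: admissible_reverse.
  - move=> G' x1' aG' lt; apply: IH aG' _; move: lt.
    by rewrite /smaller deg_reverse.
  - move=> A AS A1 AnS; rewrite deg_reverse dem_reverse dist_modN //; exact: sG.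
  - by move=> x xS; rewrite dem_reverse dist_modN // nz.
  - move=> x xS; rewrite dem_reverse dist_modN //.
    have [|j hj] := negP' x.
      by apply/negP => px; have : x \in P; [rewrite inE xS | rewrite P0 inE].
    by exists (- j); rewrite [X in - X = _]hj; set n := N _; lia.
have [PE|PnS] := eqVneq P (verts G).
  apply: (solvable_positive aG) => // x; rewrite -PE inE => /andP[_].
  exact: posP.
have [e [x [y [exy]]]] := cross_edge aG S1 nz PS P0 PnS.
rewrite !inE => /andP[xS px] /andP[ynP yS].
have {}ynP : ~~ pos y by move: ynP; rewrite yS.
apply: (solvable_opposite aG IH sG nz exy _ (posP _ px) (negP' _ ynP)).
by apply: contraNneq ynP => <-.
Qed.

(** Well-founded induction along [smaller], as three nested inductions on strict bounds for its
    components. *)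
Theorem admissible_solvable (G : network) x1 : admissible G x1 -> solvable G.
Proof.
suff h n p q (G' : network) y1 : admissible G' y1 -> (#|verts G'| < n)%N ->
    (nonloops G' < p)%N -> deg G' (verts G') < q%:Z -> solvable G'.
  move=> aG; apply: (h #|verts G|.+1 (nonloops G).+1 (absz (deg G (verts G))).+1 _ x1) => //.
  by lia.
elim: n p q G' y1 => // n IHn p; elim: p => // p IHp q; elim: q => [|q IHq] G' y1 aG hn hp hq.
  suff : 0 <= deg G' (verts G') by lia.
  rewrite /deg addr_ge0 ?cut_ge0 // sumr_ge0 // => x _.
  by rewrite addr_ge0 ?(ain_ge0 aG) ?(aout_ge0 aG).
apply: solvable_step aG _ => H x1' aH [lt|[eS [lt|[eN lt]]]].
- apply: (IHn (nonloops H).+1 (absz (deg H (verts H))).+1 _ _ aH) => //; lia.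
- apply: (IHp (absz (deg H (verts H))).+1 _ _ aH) => //; lia.
- by apply: (IHq _ _ aH) => //; lia.
Qed.

End Network.

(** * Lifting a flow modulo M to an integer flow *)

Section ModularFlow.
Variables (E V : finType) (s t : E -> V) (M : int) (p : E -> int).
Hypotheses (M_gt0 : 0 < M) (p_bounds : forall e, 0 < p e < M).

Definition excess (c : E -> bool) (A : {set V}) : int :=
  \sum_e (p e - (c e)%:Z * M) * ((s e \in A)%:Z - (t e \in A)%:Z).

(** An arc points along the positive direction of the chosen value p e or p e - M. Switching the
    choice moves M units of excess from its tail to its head. *)
Let tail (c : E -> bool) e := if c e then t e else s e.
Let head (c : E -> bool) e := if c e then s e else t e.
Let arc (c : E -> bool) : rel V :=
  fun u w => [exists e, (tail c e == u) && (head c e == w)].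

Lemma excess_flip c e0 A : excess (fun e => if e == e0 then ~~ c e else c e) A =
  excess c A - M * (tail c e0 \in A)%:Z + M * (head c e0 \in A)%:Z.
Proof.
rewrite /excess (bigD1 e0) //= [in RHS](bigD1 e0) //= eqxx.
under eq_bigr => e /negPf-> do [].
set S := \sum_(e | _) _; rewrite /tail /head; case: (c e0) => /=; lia.
Qed.

(** Switching every arc of a simple path moves M units from its first to its last vertex. The first
    arc has tail v, which the remaining path avoids, so switching it does not disturb the later
    arcs. *)
Lemma excess_path c v q : path (arc c) v q -> uniq (v :: q) ->
  exists c', forall A, excess c' A =
    excess c A - M * (v \in A)%:Z + M * (last v q \in A)%:Z.
Proof.
elim: q c v => [|u q IHq] c v /=; first by exists c => A; lia.
case/andP=> /existsP[e0 /andP[/eqP tl /eqP hd]] pq /andP[vq uq].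
pose c1 e := if e == e0 then ~~ c e else c e.
have [|//|c' hc'] := IHq c1 u.
  apply: (sub_in_path (P := mem (u :: q)) _ _ pq); last exact/allP.
  move=> x y xq yq /existsP[e /andP[/eqP te /eqP he]].
  apply/existsP; exists e; rewrite /tail /head /c1.
  case: (eqVneq e e0) => [ee|_]; last by rewrite -/(tail c e) -/(head c e) te he !eqxx.
  by move: vq; rewrite -tl -ee te => /negP[].
exists c' => A; rewrite hc' /c1 excess_flip tl hd; lia.
Qed.

Lemma excess_partition c (A : {set V}) : excess c A = \sum_(v in A) excess c [set v].
Proof.
rewrite exchange_big /=; apply: eq_bigr => e _; rewrite -big_distrr /= sumrB.
by congr (_ * (_ - _)); rewrite -sum_eq_mem; apply: eq_bigr => x _; rewrite inE.
Qed.

Hypothesis p_flow : forall v, exists j : int, excess (fun=> false) [set v] = j * M.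

Lemma excess_mod c v : exists j : int, excess c [set v] = j * M.
Proof.
have [j hj] := p_flow v.
exists (j - \sum_e (c e)%:Z * ((s e \in [set v])%:Z - (t e \in [set v])%:Z)).
rewrite mulrBl -hj mulr_suml /excess -sumrB; apply: eq_bigr => e _ /=; ring.
Qed.

(* Excess is pushed along arcs from a vertex of positive excess to one of
   negative excess; the set reached from a vertex of positive excess has no
   arc leaving it, hence nonpositive total excess. *)
Theorem modular_flow_lift : exists c, forall v, excess c [set v] = 0.
Proof.
suff h n c : (\sum_v absz (excess c [set v]) < n)%N ->
    exists c', forall v, excess c' [set v] = 0.
  exact: (h (\sum_v absz (excess (fun=> false) [set v])).+1 (fun=> false)).
elim: n c => // n IHn c hn.
have [/existsP[v0 v0p]|nopos] := boolP [exists v, 0 < excess c [set v]]; last first.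
  exists c.
  have le0 v : 0 <= - excess c [set v].
    by rewrite oppr_ge0 leNgt; apply: contraNN nopos => hv; apply/existsP; exists v.
  have : \sum_(v in [set: V]) (- excess c [set v]) == 0.
    rewrite sumrN -excess_partition oppr_eq0 /excess big1 // => e _.
    by rewrite !inE subrr mulr0.
  rewrite psumr_eq0 // => /allP h v; apply/eqP; rewrite -oppr_eq0.
  by have := h v (mem_index_enum _); rewrite inE.
pose X := [set w | connect (arc c) v0 w].
have v0X : v0 \in X by rewrite inE connect0.
have [/existsP[w /andP[wX wn]]|noneg] := boolP [exists w, (w \in X) && (excess c [set w] < 0)].
  move: wX; rewrite inE => /connectP[q0 pq0 ew].
  case/shortenP: pq0 ew => q pq uq _ ew.
  have [c' hc'] := excess_path pq uq; rewrite -ew in hc'.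
  apply: (IHn c'); have {}hc' v : excess c' [set v] = excess c [set v]
      - M * (v == v0)%:Z + M * (v == w)%:Z.
    by rewrite hc' !inE [v0 == v]eq_sym [w == v]eq_sym.
  have v0w : w != v0 by apply: contraTneq wn => ->; rewrite -leNgt ltW.
  rewrite ltnS in hn; apply: leq_trans hn.
  rewrite (bigD1 v0) //= (bigD1 w) //= [X in (_ <= X)%N](bigD1 v0) //=
    [X in (_ <= _ + X)%N](bigD1 w) //=.
  have -> : (\sum_(i | (i != v0) && (i != w)) absz (excess c' [set i]) =
      \sum_(i | (i != v0) && (i != w)) absz (excess c [set i]))%N.
    apply: eq_bigr => v /andP[/negPf h1 /negPf h2].
    by rewrite hc' h1 h2 !mulr0 subr0 addr0.
  rewrite !hc' !eqxx (negPf v0w) [v0 == w]eq_sym (negPf v0w) !mulr1 !mulr0 addr0 subr0.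
  have [i hi] := excess_mod c v0; have [j hj] := excess_mod c w.
  (* Excesses are multiples of M, so moving M units overshoots at neither end and the total absolute
     excess drops. *)
  have hM : M <= excess c [set v0].
    by rewrite hi; rewrite hi pmulr_lgt0 // in v0p; rewrite -{1}[M]mul1r ler_pM2r //; lia.
  have hM' : excess c [set w] <= - M.
    rewrite hj; rewrite hj pmulr_llt0 // in wn; rewrite -mulN1r ler_pM2r //; lia.
  by move: v0p wn hM hM' M_gt0; clear; set a := excess _ _; set b := excess _ _; lia.
have : 0 < excess c X.
  rewrite excess_partition (bigD1 v0) //= ltr_wpDr // sumr_ge0 // => v /andP[vX _].
  by rewrite leNgt; apply: contraNN noneg => hv; apply/existsP; exists v; rewrite vX.
suff : excess c X <= 0 by lia.
rewrite /excess sumr_le0 // => e _.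
have closed : tail c e \in X -> head c e \in X.
  rewrite !inE => h; apply: connect_trans h (connect1 _).
  by apply/existsP; exists e; rewrite !eqxx.
have := p_bounds e; move: closed; rewrite /tail /head.
case: (c e); case: (s e \in X); case: (t e \in X) => /= h; try (by have := h isT); lia.
Qed.

End ModularFlow.

(** * Integer flows on Eulerian graphs *)

Lemma multigraph_ends (G : multigraph) : exists st : edge G -> vertex G * vertex G,
  forall e, (st e).1 != (st e).2 /\ ends e = [set (st e).1; (st e).2].
Proof.
apply: (@fin_all_exists _ (fun=> (vertex G * vertex G)%type)
  (fun e st => st.1 != st.2 /\ ends e = [set st.1; st.2])) => e.
have /cards2P[x [y [xy ee]]] : #|ends e| == 2 by rewrite card_ends.
by exists (x, y).
Qed.

Section Orientation.
Variables (G : multigraph) (s t : edge G -> vertex G).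
Hypotheses (st : forall e, s e != t e) (ends_st : forall e, ends e = [set s e; t e]).

(** With the edges of the cut deleted, A is closed under adjacency, so fewer than n of them would
    contradict edge-connectivity. *)
Lemma cut_ge n (A : {set vertex G}) : edge_connected G n ->
  A != set0 -> A != [set: vertex G] -> n%:Z <= cut s t A.
Proof.
move=> conn /set0Pn[u uA] AT.
have /existsP[v vA] : [exists v, v \notin A].
  apply: contraNT AT => /existsPn h; apply/eqP/setP => v; rewrite inE.
  by have := h v; rewrite negbK.
pose F := [set e | (s e \in A) (+) (t e \in A)].
have -> : cut s t A = #|F|%:Z.
  rewrite /cut -sum1_card (big_morph Posz PoszD erefl) [in RHS]big_mkcond /=.
  by apply: eq_bigr => e _; rewrite inE; case: (_ (+) _).
suff : (n <= #|F|)%N by lia.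
rewrite leqNgt; apply/negP => /conn[_ /(_ u v) uv].
have clA : fingraph.closed (adj_without F) (mem A).
  move=> x y /existsP[e /andP[eF /eqP ee]] /=.
  move: eF; rewrite inE; have := ends_st e; rewrite ee => exy.
  have xin : x \in [set s e; t e] by rewrite -exy !inE eqxx.
  have yin : y \in [set s e; t e] by rewrite -exy !inE eqxx orbT.
  have := st e; move: xin yin; rewrite !inE.
  by do 2 case/orP=> /eqP->; move=> _; case: (s e \in A); case: (t e \in A).
by have := closed_connect clA uv; rewrite /= uA (negPf vA).
Qed.

(** The cut is the degree sum over A minus twice the number of edges inside A. *)
Lemma cut_even (A : {set vertex G}) : (forall v : vertex G, ~~ odd (degree v)) ->
  exists j : int, cut s t A = j * 2.
Proof.
move=> ev.
have degE v : (degree v)%:Z = \sum_e ((s e == v)%:Z + (t e == v)%:Z).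
  rewrite /degree -sum1_card (big_morph Posz PoszD erefl) big_mkcond /=.
  apply: eq_bigr => e _; rewrite inE ends_st !inE [v == s e]eq_sym [v == t e]eq_sym.
  by have := st e; case: (eqVneq (s e) v) => [->|_]; case: (eqVneq (t e) v).
have sumA : \sum_(v in A) (degree v)%:Z = \sum_e ((s e \in A)%:Z + (t e \in A)%:Z).
  rewrite (eq_bigr _ (fun v _ => degE v)) exchange_big /=.
  by apply: eq_bigr => e _; rewrite big_split /= !sum_eq_mem.
exists (\sum_(v in A) (degree v)./2%:Z - \sum_e ((s e \in A) && (t e \in A))%:Z).
rewrite mulrBl !mulr_suml [X in _ = X - _](eq_bigr (fun v => (degree v)%:Z)); last first.
  by move=> v _; have := odd_double_half (degree v); rewrite (negPf (ev v)); lia.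
rewrite sumA -sumrB; apply: eq_bigr => e _.
by case: (s e \in A); case: (t e \in A).
Qed.

End Orientation.

Theorem eulerian_integer_flow (k : nat) (G : multigraph) (sigma : signature G) :
  (0 < k)%N -> eulerian G -> edge_connected G (6 * k - 2) ->
  exists (s t : edge G -> vertex G) (g : edge G -> int),
  [/\ forall e, ends e = [set s e; t e],
      forall e, sigma e -> `|g e| = 2 * k%:Z - 1 \/ `|g e| = 2 * k%:Z + 1,
      forall e, ~~ sigma e -> `|g e| = 1 \/ `|g e| = 4 * k%:Z - 1
    & forall v, \sum_(e | s e == v) g e = \sum_(e | t e == v) g e].
Proof.
move=> k0 [[V0 _] ev] conn.
have [st hst] := multigraph_ends G.
pose s e := (st e).1; pose t e := (st e).2.
have st_neq e : s e != t e by case: (hst e).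
have st_ends e : ends e = [set s e; t e] by case: (hst e).
pose m : int := 2 * k%:Z.
have m_gt1 : 1 < m by rewrite /m; lia.
have m_gt0 : 0 < m by lia.
(* Positive edges will carry m + 1 or m - 1 from s to t; [r] cancels the contribution of the common
   term m. *)
pose r v := - (m * \sum_e (sigma e)%:Z * ((s e == v)%:Z - (t e == v)%:Z)).
pose H := Network [set: vertex G] s t r (fun=> 0) (fun=> 0).
have /card_gt0P[x1 _] := V0.
have demE (A : {set vertex G}) : dem H A = \sum_(v in A) r v.
  by apply: eq_bigr => v _ /=; rewrite addr0 subr0.
have degE (A : {set vertex G}) : deg H A = cut s t A.
  by rewrite /deg big1 ?addr0.
have aH : admissible m H x1.
  split=> //=; rewrite ?degE.
  - exists 0; rewrite mul0r addr0 /r sumrN -mulr_sumr exchange_big /= big1 ?mulr0 ?oppr0 //.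
    by move=> e _; rewrite -mulr_sumr sumrB !sum_eq_mem !inE subrr mulr0.
  - move=> A _; rewrite degE demE.
    have [j ->] := cut_even st_neq st_ends A ev.
    rewrite /r sumrN -mulr_sumr; set z := \sum_(v in A) _.
    by exists (j + k%:Z * z); rewrite /m; ring.
  - have /andP[h _] := dist_mod_bounds m_gt0 (dem H [set: vertex G]).
    rewrite /cut big1; last by move=> e _; rewrite !inE.
    by move: h; set n := dist_mod _ _; lia.
  (* The connectivity 6k - 2 is 3m - 2, and N is at most m. *)
  - move=> A _ A0 AT; right; rewrite degE.
    have /andP[_ h] := dist_mod_bounds m_gt0 (dem H A).
    have := cut_ge st_neq st_ends conn A0 AT; move: h; rewrite /m.
    by set n := dist_mod _ _; set d := cut _ _ _; lia.
have [o ho] := admissible_solvable m_gt1 aH.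
(* Representatives in (0, 2m) of m + 1, m - 1 on positive edges and of 1, -1 on negative ones. *)
pose p e : int := if sigma e then m + sg (o e) else if o e then 1 else 2 * m - 1.
have p_bounds e : 0 < p e < 2 * m.
  by rewrite /p /sg; case: (sigma e); case: (o e); lia.
have p_flow v : exists j : int, excess s t (2 * m) p (fun=> false) [set v] = j * (2 * m).
  have [j hj] := ho v (in_setT v).
  exists (j + \sum_e (~~ sigma e && ~~ o e)%:Z * ((s e == v)%:Z - (t e == v)%:Z)).
  have hj' : outflow s t o [set v] - r v = j * (2 * m).
    by rewrite [outflow _ _ _ _]hj addrC addKr.
  rewrite [RHS]mulrDl -hj' /r opprK mulr_sumr mulr_suml /outflow -!big_split /=.
  apply: eq_bigr => e _; rewrite !inE mul0r subr0 /p /sg.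
  by case: (sigma e); case: (o e) => /=; ring.
have M_gt0 : 0 < 2 * m by lia.
have [c hc] := modular_flow_lift M_gt0 p_bounds p_flow.
exists s, t, (fun e => p e - (c e)%:Z * (2 * m)); split=> //.
- by move=> e se; rewrite /p se /sg /m; case: (o e); case: (c e) => /=; lia.
- by move=> e /negPf se; rewrite /p se /m; case: (o e); case: (c e) => /=; lia.
- move=> v; apply/eqP; rewrite -subr_eq0; apply/eqP.
  rewrite big_mkcond [X in _ - X]big_mkcond -sumrB -[RHS](hc v) /=.
  apply: eq_bigr => e _; rewrite !inE.
  by case: (s e == v); case: (t e == v); rewrite /= ?mulr1 ?mulr0 ?subr0 ?sub0r ?mulrN1 ?subrr ?mulr0 ?oppr0.
Qed.

(* Rescaling to a real circular flow *)
From mathcomp Require Import all_classical all_reals all_analysis.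
Import Order.TTheory GRing.Theory Num.Theory.
Local Open Scope ring_scope.

Theorem theorem5p15 (R : realType) (k : nat) (k_gt0 : (0 < k)%N)
    (G : multigraph) (sigma : signature G) (G_eulerian : eulerian G)
    (G_conn : edge_connected G (6 * k - 2)%N) :
  (circular_flow_index R sigma <= (4 * k%:R / (2 * k%:R - 1))%:E)%E.
Proof.
have [s [t [g [ends_st g_pos g_neg g_flow]]]] :=
  eulerian_integer_flow sigma k_gt0 G_eulerian G_conn.
pose q : R := 2 * k%:R - 1; pose i := q^-1.
have q_ge1 : 1 <= q by have : 1 <= k%:R :> R; [rewrite ler1n | rewrite /q; lra].
have q_gt0 : 0 < q by lra.
have qi : q * i = 1 by rewrite divff // gt_eqF.
have i_gt0 : 0 < i by rewrite invr_gt0.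
(* For r = 2 + 2i the bounds r - 1, r/2 - 1 and r/2 + 1 are 1 + 2i, i and 2 + i, so the scaled
   values lie on the ends of the allowed intervals. *)
have -> : 4 * k%:R / (2 * k%:R - 1) = 2 + 2 * i.
  rewrite -/q -/i (_ : 4 * k%:R = 2 * q + 2); last by rewrite /q; lra.
  by rewrite mulrDl -mulrA qi; lra.
apply: ereal_inf_lbound; exists (2 + 2 * i) => //; split; first lra.
exists (Orientation ends_st), (fun e => (g e)%:~R * i).
have normE e : `|(g e)%:~R * i| = `|g e|%:~R * i.
  by rewrite normrM (gtr0_norm i_gt0) intr_norm.
have kE : k%:Z%:~R = k%:R :> R by [].
have posE e : sigma e -> `|(g e)%:~R * i| = 1 \/ `|(g e)%:~R * i| = 1 + 2 * i.
  move=> /g_pos[] e0; rewrite normE e0.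
    left; rewrite -[RHS]qi /q; congr (_ * i).
    by rewrite intrB intrM kE.
  right; rewrite -[X in X + 2 * i]qi -mulrDl /q; congr (_ * i).
  by rewrite intrD intrM kE; lra.
have negE e : ~~ sigma e -> `|(g e)%:~R * i| = i \/ `|(g e)%:~R * i| = 2 + i.
  move=> /g_neg[] e0; rewrite normE e0; first by left; rewrite mul1r.
  right; rewrite intrB intrM kE.
  have -> : 2 + i = (2 * q + 1) * i by rewrite mulrDl -mulrA qi mulr1 mul1r.
  by rewrite /q; congr (_ * i); lra.
split.
- move=> e; rewrite -ltr_norml.
  by case: (boolP (sigma e)) => [/posE|/negE] [] ->; lra.
- by move=> e /posE[] ->; apply/andP; split; lra.
- move=> e /negE[] ->; apply/orP; [left | right]; apply/andP; split; lra.
- move=> v; rewrite /boundary /= -!mulr_suml -!rmorph_sum /= g_flow.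
  by rewrite subrr.
Qed.
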